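(* The realization space $\mathcal{R}_{\mathbf 0}(C_4^{(24)})\subset\mathbb{R}^{192}$ is not smooth at any point that corresponds to a realization of the 24-cell as a regular polytope.
   Context: The 24-cell $C_4^{(24)}$ is the (combinatorial type of the) regular $4$-polytope $\operatorname{conv}\{\pm\mathbf e_i\pm\mathbf e_j\mid 1\le i<j\le 4\}\subset\mathbb{R}^4$; it has $24$ vertices and $24$ facets. For a labeled $d$-polytope $P$ (vertices and facets numbered) with $n$ vertices and $m$ facets, a labeled $d$-polytope $Q\subset\mathbb{R}^d$ realizes $P$ if there is an isomorphism between the face lattices of $P$ and $Q$ respecting the labels of vertices and facets. The centered realization space is $$\mathcal{R}_{\mathbf 0}(P)=\{(V,A)\in\mathbb{R}^{d\times(n+m)} \mid \operatorname{conv}(V)=\{\mathbf x\in\mathbb{R}^d\mid A^t\mathbf x\le\mathbf 1\}\text{ realizes }P\},$$ where $\operatorname{conv}(V)$ is the convex hull of the columns of $V$. A point $(V,A)\in\mathcal{R}_{\mathbf 0}(C_4^{(24)})$ corresponds to a realization as a regular polytope if $\operatorname{conv}(V)$ is a regular polytope. ''Not smooth at a point'' means that no neighborhood of the point in $\mathcal{R}_{\mathbf 0}(C_4^{(24)})$ is a smoothly embedded submanifold of the ambient space $\mathbb{R}^{192}$. *)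

(* Defs.v *)
From HB Require Import structures.
From mathcomp Require Import all_boot all_order all_algebra.
From mathcomp Require Import all_classical all_reals all_analysis.

Set Implicit Arguments.
Unset Strict Implicit.
Unset Printing Implicit Defensive.

Import Order.TTheory GRing.Theory Num.Theory.
Import numFieldNormedType.Exports.

Local Open Scope classical_set_scope.
Local Open Scope ring_scope.

(** * Convex polytopes in R^d (points are column vectors) *)

Definition dotcv (R : realType) (d : nat) (x y : 'cV[R]_d) : R :=
  (x^T *m y) ord0 ord0.

Definition convex_hull (R : realType) (d : nat) (S : set 'cV[R]_d) :
    set 'cV[R]_d :=
  smallest (@convex_set R 'cV[R]_d) S.

Definition conv_cols (R : realType) (d n : nat) (V : 'M[R]_(d, n)) :
    set 'cV[R]_d :=
  convex_hull (range (fun i : 'I_n => col i V)).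

Definition ineq_set (R : realType) (d m : nat) (A : 'M[R]_(d, m)) :
    set 'cV[R]_d :=
  [set x | forall j : 'I_m, (A^T *m x) j ord0 <= 1].

Definition is_polytope (R : realType) (d : nat) (P : set 'cV[R]_d) : Prop :=
  exists (n : nat) (V : 'M[R]_(d, n)), P = conv_cols V.

(** [x0 + U] is the affine hull of [S]. *)
Definition has_affdim (R : realType) (d : nat) (S : set 'cV[R]_d) (k : nat) :
    Prop :=
  exists (x0 : 'cV[R]_d) (U : {vspace 'cV[R]_d}),
    [/\ S x0,
        forall x, S x -> x - x0 \in U,
        forall W : {vspace 'cV[R]_d},
          (forall x, S x -> x - x0 \in W) -> (U <= W)%VS
      & \dim U = k].

(** Taking [c = 0], both the empty set and [P] itself are faces of [P]. *)
Definition face (R : realType) (d : nat) (P F : set 'cV[R]_d) : Prop :=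
  exists (c : 'cV[R]_d) (b : R),
    (forall x, P x -> dotcv c x <= b) /\
    F = P `&` [set x | dotcv c x = b].

Definition vertex (R : realType) (d : nat) (P : set 'cV[R]_d) (x : 'cV[R]_d) :
    Prop :=
  face P [set x].

Definition facet (R : realType) (d : nat) (P F : set 'cV[R]_d) : Prop :=
  face P F /\ exists k : nat,
    [/\ has_affdim F k & has_affdim P k.+1].

(** * Labeled polytopes and the centered realization space *)

Record labeled_polytope (R : realType) (d n m : nat) := LabeledPolytope {
  lp_body : set 'cV[R]_d;
  lp_vertex : 'I_n -> 'cV[R]_d;
  lp_facet : 'I_m -> set 'cV[R]_d;
  lp_polytope : is_polytope lp_body;
  lp_dim : has_affdim lp_body d;
  lp_vertex_bij : set_bij [set: 'I_n] (vertex lp_body) lp_vertex;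
  lp_facet_bij : set_bij [set: 'I_m] (facet lp_body) lp_facet
}.

(** An order isomorphism between lattices is the same as a lattice
    isomorphism. *)
Definition realizes (R : realType) (d n m : nat)
    (Q P : labeled_polytope R d n m) : Prop :=
  exists phi : set 'cV[R]_d -> set 'cV[R]_d,
    [/\ set_bij (face (lp_body P)) (face (lp_body Q)) phi,
        forall F G, face (lp_body P) F -> face (lp_body P) G ->
          (phi F `<=` phi G <-> F `<=` G),
        forall i, phi [set lp_vertex P i] = [set lp_vertex Q i]
      & forall j, phi (lp_facet P j) = lp_facet Q j].

(** A pair [(V, A)] is encoded as the block matrix [row_mx V A].  The [i]-th
    vertex of the realization is the [i]-th column of [V], and its [j]-th
    facet is the one cut out by the [j]-th column of [A]. *)
Definition realization_space (R : realType) (d n m : nat)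
    (P : labeled_polytope R d n m) : set 'M[R]_(d, n + m) :=
  [set VA | let V := lsubmx VA in let A := rsubmx VA in
    conv_cols V = ineq_set A /\
    exists Q : labeled_polytope R d n m,
      [/\ lp_body Q = conv_cols V,
          forall i, lp_vertex Q i = col i V,
          forall j, lp_facet Q j =
            conv_cols V `&` [set x | dotcv (col j A) x = 1]
        & realizes Q P]].

(** The regular 24-cell. *)
Definition cell24 (R : realType) : set 'cV[R]_4 :=
  convex_hull [set x | exists (i j : 'I_4) (s t : bool), (i < j)%N /\
    x = (-1) ^+ s *: delta_mx i ord0 + (-1) ^+ t *: delta_mx j ord0].

(** * Regular polytopes *)

Definition isometry (R : realType) (d : nat) (f : 'cV[R]_d -> 'cV[R]_d) :
    Prop :=
  forall x y, dotcv (f x - f y) (f x - f y) = dotcv (x - y) (x - y).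

Definition face_chain (R : realType) (d : nat) (P : set 'cV[R]_d)
    (C : set (set 'cV[R]_d)) : Prop :=
  C `<=` face P /\ forall F G, C F -> C G -> F `<=` G \/ G `<=` F.

Definition flag (R : realType) (d : nat) (P : set 'cV[R]_d)
    (C : set (set 'cV[R]_d)) : Prop :=
  face_chain P C /\ forall C', face_chain P C' -> C `<=` C' -> C' = C.

(** The symmetry group of [P] acts transitively on the flags of [P]. *)
Definition regular_polytope (R : realType) (d : nat) (P : set 'cV[R]_d) :
    Prop :=
  is_polytope P /\
  forall C C', flag P C -> flag P C' ->
    exists f : 'cV[R]_d -> 'cV[R]_d,
      [/\ isometry f, f @` P = P & (fun F => f @` F) @` C = C'].

(** * Smoothly embedded submanifolds of a space of matrices *)

(** Meant for [U] open.  As the spaces are finite-dimensional, this is the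
    usual notion of being of class C^k. *)
Fixpoint Ck_on (R : realType) (E F : normedModType R) (k : nat) (U : set E)
    (f : E -> F) : Prop :=
  match k with
  | 0 => forall x, U x -> {for x, continuous f}
  | k'.+1 => (forall x, U x -> differentiable f x) /\
             forall v : E, Ck_on k' U (fun x => 'D_v f x)
  end.

Definition smooth_on (R : realType) (E F : normedModType R) (U : set E)
    (f : E -> F) : Prop :=
  forall k, Ck_on k U f.

Definition diffeo (R : realType) (E F : normedModType R) (U : set E)
    (W : set F) (f : E -> F) (g : F -> E) : Prop :=
  [/\ smooth_on U f, smooth_on W g,
      f @` U = W, g @` W = U & {in U, cancel f g}].

Definition coord_slice (R : realType) (N k : nat) : set 'rV[R]_N :=
  [set y | forall i : 'I_N, (k <= i)%N -> y ord0 i = 0].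

(** Around each of its points, [S] is a [k]-dimensional slice in some smooth
    chart of the ambient space. *)
Definition embedded_submanifold (R : realType) (a b k : nat)
    (S : set 'M[R]_(a, b)) : Prop :=
  (k <= a * b)%N /\
  forall p, S p ->
    exists (U : set 'M[R]_(a, b)) (W : set 'rV[R]_(a * b))
           (f : 'M[R]_(a, b) -> 'rV[R]_(a * b))
           (g : 'rV[R]_(a * b) -> 'M[R]_(a, b)),
      [/\ open U, U p, open W, diffeo U W f g
        & f @` (S `&` U) = coord_slice k `&` W].

Definition smooth_at (R : realType) (a b : nat) (M : set 'M[R]_(a, b))
    (p : 'M[R]_(a, b)) : Prop :=
  exists (N : set 'M[R]_(a, b)) (k : nat),
    nbhs p N /\ embedded_submanifold k (M `&` N).

(* Main.v *)
Require Import Defs.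
From mathcomp Require Import all_boot all_order all_algebra.
From mathcomp Require Import all_classical all_reals all_analysis.
From mathcomp Require Import ring lra zify.

Set Implicit Arguments.
Unset Strict Implicit.
Unset Printing Implicit Defensive.

Import Order.TTheory GRing.Theory Num.Theory.
Import numFieldNormedType.Exports.

Local Open Scope classical_set_scope.
Local Open Scope ring_scope.

(** The realization space is singular at a regular point because its tangent
    directions there are not closed under addition.

    Write [v_i] and [a_j] for the columns of [V] and [A].  Near any of its
    points the realization space is the zero set of the quadratic equations
    [a_j . v_i = 1], one for each incident pair of a vertex and a facet
    ([realization_near]).  Let [w_ij] be weights on the incident pairs of a
    realization [p] with [sum_j w_ij a_j = 0] for every [i] and
    [sum_i w_ij v_i = 0] for every [j], that is, a linear dependency between
    the differentials at [p] of the equations.  As the equations are quadratic,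
    the form [q(h) = sum_ij w_ij da_j . dv_i] in [h = (dv, da)] vanishes at
    [x - p] for every realization [x], with no error term; so [q] vanishes at
    the velocity of every curve of realizations that starts at [p].  If the
    realization space were a submanifold near [p], these velocities would form
    a linear space, and [q] would also vanish at their sums
    ([smooth_at_quadratic]).

    The regular 24-cell has such weights.  Its 24 vertices split into three
    cross-polytopes, and so do its 24 facet normals.  Each vertex lies on two
    facets with normals in a given cross-polytope, and these two normals have
    the same sum for all three cross-polytopes; the dual statement holds for
    the vertices of a facet.  Hence one may take [w_ij] to be the product of a
    number that depends on the cross-polytope of [v_i] and a number that
    depends on that of [a_j], with sum zero over the three cross-polytopes in
    both cases.  It also has curves of realizations.  Let [n] be such that no
    facet has vertices on one side of the hyperplane orthogonal to [n] and its
    normal on the other side.  Stretching the open half-space [n . x > 0] by a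
    factor [1 + t] in the direction [n], and contracting the normals in this
    half-space correspondingly, preserves all incidences.  Both a facet normal
    [e_1] and a vertex [e_2 - e_1] are possible choices for [n], and [q] does
    not vanish at the sum of the two velocities ([obstruction_neq0]).

    An arbitrary regular realization reduces to the standard one.  Transitivity
    on flags gives all its edges the same length ([regular_edge]).  In an
    octahedron with equal edges the diagonals have the same midpoint
    ([octahedron_midpoints]), and the resulting linear relations between the
    24 vertices admit only affine solutions ([oct_relations_affine]).  So the
    vertices are [L w_i + c] for the standard vertices [w_i], the facet normals
    are determined up to scaling, and the weights and both curves can be
    carried over. *)

(** * Inner products *)

Section Dot.
Context {R : realType} {d : nat}.
Implicit Types x y z u : 'cV[R]_d.

Lemma dotE x y : dotcv x y = \sum_k x k 0 * y k 0.
Proof. by rewrite /dotcv mxE; apply: eq_bigr => k _; rewrite mxE. Qed.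

Lemma dotC x y : dotcv x y = dotcv y x.
Proof. by rewrite !dotE; apply: eq_bigr => k _; rewrite mulrC. Qed.

Lemma dotDl x y z : dotcv (x + y) z = dotcv x z + dotcv y z.
Proof. by rewrite /dotcv linearD mulmxDl mxE. Qed.

Lemma dotDr x y z : dotcv x (y + z) = dotcv x y + dotcv x z.
Proof. by rewrite /dotcv mulmxDr mxE. Qed.

Lemma dotZl k x y : dotcv (k *: x) y = k * dotcv x y.
Proof. by rewrite /dotcv linearZ -scalemxAl mxE. Qed.

Lemma dotZr k x y : dotcv x (k *: y) = k * dotcv x y.
Proof. by rewrite dotC dotZl dotC. Qed.

Lemma dotNl x y : dotcv (- x) y = - dotcv x y.
Proof. by rewrite -scaleN1r dotZl mulN1r. Qed.

Lemma dotNr x y : dotcv x (- y) = - dotcv x y.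
Proof. by rewrite dotC dotNl dotC. Qed.

Lemma dotBl x y z : dotcv (x - y) z = dotcv x z - dotcv y z.
Proof. by rewrite dotDl dotNl. Qed.

Lemma dotBr x y z : dotcv x (y - z) = dotcv x y - dotcv x z.
Proof. by rewrite dotDr dotNr. Qed.

Lemma dot0l y : dotcv (0 : 'cV[R]_d) y = 0.
Proof. by rewrite -(scale0r 0) dotZl mul0r. Qed.

Lemma dot0r y : dotcv y (0 : 'cV[R]_d) = 0.
Proof. by rewrite dotC dot0l. Qed.

Lemma dot_suml (I : finType) (P : pred I) (F : I -> 'cV[R]_d) y :
  dotcv (\sum_(i | P i) F i) y = \sum_(i | P i) dotcv (F i) y.
Proof.
by apply: (big_morph (fun x => dotcv x y)) => [? ?|]; rewrite ?dotDl ?dot0l.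
Qed.

Lemma dot_sumr (I : finType) (P : pred I) (F : I -> 'cV[R]_d) y :
  dotcv y (\sum_(i | P i) F i) = \sum_(i | P i) dotcv y (F i).
Proof. by rewrite dotC dot_suml; apply: eq_bigr => i _; rewrite dotC. Qed.

Lemma dot_ge0 x : 0 <= dotcv x x.
Proof. by rewrite dotE sumr_ge0// => k _; rewrite -expr2 sqr_ge0. Qed.

Lemma dot_eq0 x : dotcv x x = 0 -> x = 0.
Proof.
rewrite dotE => /eqP; rewrite psumr_eq0 => [/allP h|k _]; last first.
  by rewrite -expr2 sqr_ge0.
apply/colP => k; rewrite mxE; have := h k (mem_index_enum _).
by rewrite mulf_eq0 orbb => /eqP.
Qed.

Lemma ineqE m (A : 'M[R]_(d, m)) x :
  ineq_set A x <-> forall j, dotcv (col j A) x <= 1.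
Proof.
suff e j : (A^T *m x) j ord0 = dotcv (col j A) x by split=> h j; move: (h j); rewrite e.
by rewrite dotE mxE; apply: eq_bigr => k _; rewrite !mxE.
Qed.

End Dot.

Lemma dot_mull (R : realType) (d e : nat) (L : 'M[R]_(d, e)) x y :
  dotcv (L *m x) y = dotcv x (L^T *m y).
Proof. by rewrite /dotcv trmx_mul mulmxA. Qed.

Lemma dot_col_mx (R : realType) (d e : nat) (x y : 'cV[R]_d) (s t : 'cV[R]_e) :
  dotcv (col_mx x s) (col_mx y t) = dotcv x y + dotcv s t.
Proof. by rewrite /dotcv tr_col_mx mul_row_col mxE. Qed.

(** * Convex hulls of finitely many points *)

(** Farkas' lemma, by induction on the number of vectors: if a functional [y0]
    shows that [v ord0] cannot be omitted, the other vectors and [b] are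
    projected along [v ord0] to the kernel of [y0]. *)
Lemma farkas (R : realType) (d n : nat) (v : 'I_n -> 'cV[R]_d) (b : 'cV[R]_d) :
  (forall y, (forall i, dotcv y (v i) <= 0) -> dotcv y b <= 0) ->
  exists2 mu : 'I_n -> R, (forall i, 0 <= mu i) & b = \sum_i mu i *: v i.
Proof.
elim: n v b => [|n IHn] v b hyp.
  exists (fun=> 0) => //; rewrite big_ord0; apply: dot_eq0; apply/le_anti.
  by rewrite dot_ge0 andbT; apply: hyp; case.
have [hyp'|] := pselect (forall y, (forall i, dotcv y (v (lift ord0 i)) <= 0) ->
    dotcv y b <= 0).
  have [mu mu0 ->] := IHn (fun i => v (lift ord0 i)) b hyp'.
  exists (fun i => if unlift ord0 i is Some i' then mu i' else 0).
    by move=> i; case: (unliftP ord0 i) => [j _|_]; rewrite ?mu0 ?lexx.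
  rewrite big_ord_recl unlift_none scale0r add0r.
  by apply: eq_bigr => i _; rewrite liftK.
move/existsNP => [y /not_implyP [yv /negP]]; rewrite -ltNge => yb.
have yv0 : 0 < dotcv y (v ord0).
  rewrite ltNge; apply/negP => yv0; move: yb; rewrite ltNge => /negP; apply.
  by apply: hyp => i; case: (unliftP ord0 i) => [j ->|->].
pose y0 := (dotcv y (v ord0))^-1 *: y.
have y00 : dotcv y0 (v ord0) = 1 by rewrite dotZl mulVf// gt_eqF.
have y0v i : dotcv y0 (v (lift ord0 i)) <= 0.
  by rewrite dotZl pmulr_rle0 ?invr_gt0.
have y0b : 0 < dotcv y0 b by rewrite dotZl mulr_gt0// invr_gt0.
clearbody y0; pose pr x : 'cV[R]_d := x - dotcv y0 x *: v ord0.
have [z hz|mu mu0 bE] := IHn (fun i => pr (v (lift ord0 i))) (pr b).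
  pose z' := z - dotcv z (v ord0) *: y0.
  have zE x : dotcv z (pr x) = dotcv z' x.
    by rewrite /pr /z' dotBr dotBl dotZr dotZl mulrC.
  rewrite zE; apply: hyp => i; case: (unliftP ord0 i) => [j ->|->].
    by rewrite -zE.
  by rewrite -zE /pr y00 scale1r subrr dot0r.
exists (fun i => if unlift ord0 i is Some i' then mu i' else
   dotcv y0 b - \sum_i mu i * dotcv y0 (v (lift ord0 i))).
  move=> i; case: (unliftP ord0 i) => [j _|_]; first exact: mu0.
  rewrite subr_ge0; apply: le_trans (ltW y0b).
  by apply: sumr_le0 => j _; rewrite mulr_ge0_le0.
rewrite big_ord_recl unlift_none.
under [X in _ + X]eq_bigr do rewrite liftK.
move/eqP: bE; rewrite /pr subr_eq => /eqP {1}->.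
under [X in X + _ = _]eq_bigr do rewrite scalerBr scalerA.
by rewrite sumrB -scaler_suml scalerBl addrC [X in _ + X = _]addrC addrA.
Qed.

Lemma conv_colsP (R : realType) (d n : nat) (V : 'M[R]_(d, n)) x :
  conv_cols V x <-> exists mu : 'I_n -> R,
    [/\ forall i, 0 <= mu i, \sum_i mu i = 1 & x = \sum_i mu i *: col i V].
Proof.
split.
  pose C := [set x | exists mu : 'I_n -> R,
    [/\ forall i, 0 <= mu i, \sum_i mu i = 1 & x = \sum_i mu i *: col i V]].
  apply: (_ : conv_cols V `<=` C); apply: smallest_sub.
    move=> a b t; rewrite !inE => -[mu [mu0 mu1 ->]] [nu [nu0 nu1 ->]].
    have t0 : 0 <= t%:num :> R by [].
    have t1 : 0 <= 1 - t%:num :> R by rewrite subr_ge0.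
    exists (fun i => t%:num * mu i + (1 - t%:num) * nu i); split.
    - by move=> i; rewrite addr_ge0 ?mulr_ge0.
    - by rewrite big_split /= -!mulr_sumr mu1 nu1 !mulr1 subrKC.
    - rewrite [LHS]/conv/=.
      under [RHS]eq_bigr do rewrite scalerDl -!scalerA.
      by rewrite big_split /= -!scaler_sumr.
  move=> _ [i _ <-]; exists (fun j => (j == i)%:R); split => [j||].
  - by rewrite ler0n.
  - by rewrite (bigD1 i)//= eqxx big1 ?addr0// => j /negbTE ->.
  - rewrite (bigD1 i)//= eqxx scale1r big1 ?addr0// => j /negbTE ->.
    by rewrite scale0r.
move=> [mu [mu0 mu1 ->]] C [Cc CV].
have {CV}CV i : C (col i V) by apply: CV; exists i.
have [i0 mui0] : exists i0, 0 < mu i0.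
  apply: contrapT => /forallNP h; have := ltr01 (R := R).
  rewrite -mu1 ltNge => /negP; apply; apply: sumr_le0 => i _.
  by rewrite leNgt; apply/negP/h.
(* Points are added one by one, normalizing the weights used so far. *)
suff key : forall (s : seq 'I_n), 0 < \sum_(i <- s) mu i ->
    C ((\sum_(i <- s) mu i)^-1 *: \sum_(i <- s) mu i *: col i V).
  by have := key (index_enum 'I_n); rewrite mu1 invr1 scale1r; apply; rewrite ltr01.
elim => [|i s IHs]; first by rewrite big_nil ltxx.
rewrite !big_cons => pos; set S := \sum_(j <- s) mu j in pos IHs *.
have S0 : 0 <= S by apply: sumr_ge0.
have [S_eq0|S_neq0] := eqVneq S 0.
  have -> : \sum_(j <- s) mu j *: col j V = 0.
    rewrite big_seq; apply: big1 => j js.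
    move: S_eq0 => /eqP; rewrite psumr_eq0// => /allP /(_ j js) /eqP ->.
    by rewrite scale0r.
  move: pos; rewrite S_eq0 !addr0 => pos.
  by rewrite scalerA mulVf ?gt_eqF// scale1r.
have Spos : 0 < S by rewrite lt_neqAle eq_sym S_neq0.
have t01 : 0 <= mu i / (mu i + S) <= 1.
  rewrite divr_ge0 ?(ltW pos)//= ler_pdivrMr// mul1r lerDl//.
have /andP [l0 l1] := t01.
have := Cc (col i V) (S^-1 *: \sum_(j <- s) mu j *: col j V)
  (Itv01 l0 l1).
rewrite !inE => /(_ (CV i) (IHs Spos)); rewrite /conv/=.
congr (C _); rewrite !scalerDr !scalerA; congr (_ + _).
  by rewrite mulrC.
congr (_ *: _); rewrite /unstable.onem; field.
by rewrite gt_eqF ?andbT// gt_eqF.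
Qed.

(** * Faces and incidences *)
Section Faces.
Context {R : realType} {d n m : nat}.
Implicit Types (V : 'M[R]_(d, n)) (A : 'M[R]_(d, m)) (F G : set 'cV[R]_d).

(** Linear programming duality: the inequalities [a_j . x <= 1] and [0 <= 1]
    become vectors of dimension [d + 1] in Farkas' lemma. *)
Lemma polar_ineq A (c : 'cV[R]_d) (b : R) :
  (forall x, ineq_set A x -> dotcv c x <= b) ->
  exists mu : 'I_m -> R,
    [/\ forall j, 0 <= mu j, c = \sum_j mu j *: col j A & \sum_j mu j <= b].
Proof.
move=> hc.
have b0 : 0 <= b.
  rewrite -(dot0r c); apply: hc; rewrite ineqE => j.
  by rewrite dot0r ler01.
pose v (i : 'I_m.+1) : 'cV[R]_(d + 1) :=
  if unlift ord0 i is Some j then col_mx (col j A) (const_mx 1)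
  else col_mx 0 (const_mx 1).
have [y hy|mu mu0 E] := @farkas R (d + 1) m.+1 v (col_mx c (const_mx b)).
  rewrite -[y]vsubmxK; set y' := usubmx y; set s := dsubmx y ord0 ord0.
  have sE (t : R) : dotcv (dsubmx y) (const_mx t) = s * t.
    by rewrite dotE big_ord1 [const_mx _ _ _]mxE.
  have ys : s <= 0.
    move: (hy ord0); rewrite /v unlift_none -{1}[y]vsubmxK dot_col_mx dot0r.
    by rewrite add0r sE mulr1.
  have ya j : dotcv y' (col j A) + s <= 0.
    move: (hy (lift ord0 j)); rewrite /v liftK -{1}[y]vsubmxK dot_col_mx.
    by rewrite sE mulr1.
  rewrite dot_col_mx sE.
  have [s0|s0] := eqVneq s 0; last first.
    have sn : 0 < - s by rewrite oppr_gt0 lt_neqAle s0.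
    have /hc : ineq_set A ((- s)^-1 *: y').
      rewrite ineqE => j; rewrite dotZr mulrC ler_pdivrMr// mul1r dotC.
      by rewrite -subr_le0 opprK.
    rewrite dotZr mulrC ler_pdivrMr// dotC -subr_le0.
    by rewrite mulrN opprK [b * s]mulrC.
  (* [y'] is a direction in which the feasible set is unbounded. *)
  rewrite s0 mul0r addr0 leNgt; apply/negP => yc.
  have /hc : ineq_set A (((b + 1) / dotcv y' c) *: y').
    rewrite ineqE => j; rewrite dotZr (dotC (col j A)); apply: le_trans ler01.
    rewrite mulr_ge0_le0 ?divr_ge0 ?addr_ge0 ?(ltW yc)//.
    by move: (ya j); rewrite s0 addr0.
  rewrite dotZr (dotC c) divfK ?gt_eqF// leNgt => /negP; apply.
  by rewrite ltrDl.
move: E; rewrite big_ord_recl /v unlift_none.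
under eq_bigr do rewrite liftK.
move=> E; exists (fun j => mu (lift ord0 j)); split => //.
  have := congr1 usubmx E; rewrite linearD /= linearZ /= !col_mxKu scaler0 add0r.
  rewrite linear_sum /= => ->; apply: eq_bigr => j _.
  by rewrite linearZ /= col_mxKu.
have := congr1 (fun x => dsubmx x ord0 ord0) E.
rewrite linearD /= linearZ /= !col_mxKd linear_sum /= !mxE summxE mulr1.
move=> ->; under [X in _ <= _ + X]eq_bigr do rewrite linearZ /= col_mxKd !mxE mulr1.
by rewrite lerDr.
Qed.

Lemma conv_cols_col V i : conv_cols V (col i V).
Proof. by move=> C [_ CV]; apply: CV; exists i. Qed.

Lemma face_col V F (mu : 'I_n -> R) i : face (conv_cols V) F ->
  (forall i, 0 <= mu i) -> \sum_i mu i = 1 -> F (\sum_i mu i *: col i V) ->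
  0 < mu i -> F (col i V).
Proof.
move=> [c [b [hb ->]]] mu0 mu1 [_ /= E] mui; split; first exact: conv_cols_col.
have hV k : 0 <= b - dotcv c (col k V).
  by rewrite subr_ge0; apply: hb; exact: conv_cols_col.
have : \sum_k mu k * (b - dotcv c (col k V)) = 0.
  under eq_bigr do rewrite mulrBr.
  rewrite sumrB -mulr_suml mu1 mul1r -{1}E dot_sumr.
  by under [X in X - _]eq_bigr do rewrite dotZr; rewrite subrr.
move=> /eqP; rewrite psumr_eq0 => [/allP/(_ i)|k _]; last by rewrite mulr_ge0.
rewrite mem_index_enum => /(_ isT).
by rewrite mulf_eq0 gt_eqF//= subr_eq0 eq_sym => /eqP.
Qed.

Lemma sum1_pos (mu : 'I_n -> R) : (forall i, 0 <= mu i) -> \sum_i mu i = 1 ->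
  exists i, 0 < mu i.
Proof.
move=> mu0 mu1; apply: contrapT => /forallNP h; have := ltr01 (R := R).
rewrite -mu1 ltNge => /negP; apply; apply: sumr_le0 => i _.
by rewrite leNgt; apply/negP/h.
Qed.

Lemma face_sub V F : face (conv_cols V) F -> F `<=` conv_cols V.
Proof. by move=> [c [b [_ ->]]] x []. Qed.

Lemma face_has_col V F x : face (conv_cols V) F -> F x ->
  exists i, F (col i V).
Proof.
move=> fF Fx; have /conv_colsP[mu [mu0 mu1 xE]] := face_sub fF Fx.
have [i mui] := sum1_pos mu0 mu1.
by exists i; apply: (face_col fF mu0 mu1 _ mui); rewrite -xE.
Qed.

Lemma face_eq V F c b : face (conv_cols V) F ->
  (forall i, F (col i V) -> dotcv c (col i V) = b) ->
  forall x, F x -> dotcv c x = b.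
Proof.
move=> fF hc x Fx; have /conv_colsP[mu [mu0 mu1 xE]] := face_sub fF Fx.
have h i : mu i * dotcv c (col i V) = mu i * b.
  have [->|mui] := eqVneq (mu i) 0; first by rewrite !mul0r.
  congr (_ * _); apply: hc; apply: (face_col fF mu0 mu1); rewrite -?xE//.
  by rewrite lt_neqAle eq_sym mui mu0.
rewrite xE dot_sumr -[RHS]mul1r -mu1 mulr_suml.
by apply: eq_bigr => i _; rewrite dotZr h.
Qed.

Lemma face_sub_cols V F G : face (conv_cols V) F -> face (conv_cols V) G ->
  (forall i, F (col i V) -> G (col i V)) -> F `<=` G.
Proof.
move=> fF [c [b [_ GE]]] FG x Fx; rewrite GE; split.
  exact: (face_sub fF).
by apply: (face_eq fF) Fx => i /FG; rewrite GE => -[].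
Qed.

Lemma face_eq_cols V F G : face (conv_cols V) F -> face (conv_cols V) G ->
  (forall i, F (col i V) <-> G (col i V)) -> F = G.
Proof.
move=> fF fG FG; apply/seteqP; split.
  by apply: (face_sub_cols fF fG) => i /FG.
by apply: (face_sub_cols fG fF) => i /FG.
Qed.

Lemma face_set1 V F i : face (conv_cols V) F -> F (col i V) ->
  (forall k, F (col k V) -> k = i) -> F = [set col i V].
Proof.
move=> fF Fi hF; apply/seteqP; split => [x Fx|x ->//].
have /conv_colsP[mu [mu0 mu1 xE]] := face_sub fF Fx.
have muk k : k != i -> mu k = 0.
  move=> ki; apply/eqP; apply: contraT => muk; move: ki.
  rewrite (hF k) ?eqxx//; apply: (face_col fF mu0 mu1); rewrite -?xE//.
  by rewrite lt_neqAle eq_sym muk mu0.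
move: mu1; rewrite (bigD1 i)//= big1 ?addr0; last by move=> k /muk.
move=> mui; rewrite xE (bigD1 i)//= mui scale1r big1 ?addr0// => k /muk ->.
by rewrite scale0r.
Qed.

Definition face_cut V A (J : set 'I_m) : set 'cV[R]_d :=
  conv_cols V `&` [set x | forall j, J j -> dotcv (col j A) x = 1].

Definition active A F : set 'I_m :=
  [set j | forall x, F x -> dotcv (col j A) x = 1].

Lemma face_cut_face V A J : conv_cols V `<=` ineq_set A ->
  face (conv_cols V) (face_cut V A J).
Proof.
move=> VA; exists (\sum_(j | `[< J j >]) col j A), (\sum_(j | `[< J j >]) 1).
split=> [x /VA /ineqE xA|].
  by rewrite dot_suml; apply: ler_sum => j _; exact: xA.
apply/seteqP; split => x [Vx /= xJ]; split=> //=.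
  by rewrite dot_suml; apply: eq_bigr => j /asboolP /xJ.
move=> j Jj; have /VA /ineqE xA := Vx; move: xJ; rewrite dot_suml => /eqP.
rewrite -subr_eq0 -sumrB => /eqP E.
have : \sum_(j | `[< J j >]) (1 - dotcv (col j A) x) = 0.
  by rewrite -[LHS]opprK -sumrN; under eq_bigr do rewrite opprB; rewrite E oppr0.
move=> /eqP; rewrite psumr_eq0 => [/allP/(_ j)|k _]; last by rewrite subr_ge0.
rewrite mem_index_enum => /(_ isT) /implyP; rewrite subr_eq0 eq_sym => h.
by apply/eqP/h/asboolP.
Qed.

(** The functional that defines [F] is a nonnegative combination of facet
    normals; those with positive coefficient are constant on [F], and a point
    where they all take the value 1 lies on [F]. *)
Lemma face_cut_active V A F : conv_cols V = ineq_set A ->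
  face (conv_cols V) F -> F !=set0 -> F = face_cut V A (active A F).
Proof.
move=> VA fF [x0 Fx0]; have := fF => -[c [b [hb FE]]].
apply/seteqP; split => [x Fx|x [Vx xact]].
  by split=> [|j]; [exact: (face_sub fF)|apply].
have [|mu [mu0 cE mub]] := @polar_ineq A c b; first by rewrite -VA.
have key y : dotcv c y = \sum_j mu j * dotcv (col j A) y.
  by rewrite cE dot_suml; under eq_bigr do rewrite dotZl.
have act y j : F y -> 0 < mu j -> dotcv (col j A) y = 1.
  move=> Fy muj; have Ay : forall j, dotcv (col j A) y <= 1.
    by apply/ineqE; rewrite -VA; exact: (face_sub fF).
  have : \sum_j mu j * (1 - dotcv (col j A) y) <= 0.
    under eq_bigr do rewrite mulrBr mulr1.
    rewrite sumrB -key; move: Fy; rewrite FE => -[_ ->].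
    by rewrite subr_le0.
  have h k : 0 <= mu k * (1 - dotcv (col k A) y).
    by rewrite mulr_ge0// subr_ge0.
  rewrite le_eqVlt ltNge sumr_ge0 ?orbF//.
  rewrite psumr_eq0// => /allP/(_ j); rewrite mem_index_enum => /(_ isT).
  by rewrite mulf_eq0 gt_eqF//= subr_eq0 eq_sym => /eqP.
rewrite FE; split => //=.
have -> : b = dotcv c x0 by move: Fx0; rewrite {1}FE => -[_ ->].
rewrite !key; apply: eq_bigr => j _.
have [->|muj] := eqVneq (mu j) 0; first by rewrite !mul0r.
have {}muj : 0 < mu j by rewrite lt_neqAle eq_sym muj mu0.
by rewrite (act x0)// xact// => y Fy; exact: act.
Qed.

End Faces.

(** * Perturbing a polytope *)

Section Norm1.
Context {R : realType} {d : nat}.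
Implicit Types u w : 'cV[R]_d.

Definition norm1 u : R := \sum_k `|u k 0|.
Definition sgcv u : 'cV[R]_d := \col_k Num.sg (u k 0).

Lemma norm1_ge0 u : 0 <= norm1 u.
Proof. exact: sumr_ge0. Qed.

Lemma norm1_eq0 u : norm1 u = 0 -> u = 0.
Proof.
move=> /eqP; rewrite psumr_eq0// => /allP h; apply/colP => k; rewrite mxE.
by have := h k (mem_index_enum _); rewrite normr_eq0 => /eqP.
Qed.

Lemma dot_sgcv u : dotcv u (sgcv u) = norm1 u.
Proof. by rewrite dotE; apply: eq_bigr => k _; rewrite mxE mulrC -normrEsg. Qed.

Lemma dot_le_norm1 u w e : (forall k, `|w k 0| <= e) ->
  `|dotcv u w| <= norm1 u * e.
Proof.
move=> we; rewrite dotE mulr_suml; apply: le_trans (ler_norm_sum _ _ _) _.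
by apply: ler_sum => k _; rewrite normrM ler_wpM2l.
Qed.

Lemma sgcv_le1 u k : `|sgcv u k 0| <= 1.
Proof. by rewrite mxE normr_sg; case: eqP => //=; rewrite ?ler01. Qed.

End Norm1.

Definition mx_close (R : realType) (a b : nat) (e : R) (M N : 'M[R]_(a, b)) :=
  forall i j, `|N i j - M i j| <= e.

Lemma mx_close_col (R : realType) (a b : nat) (e : R) (M N : 'M[R]_(a, b)) i k :
  mx_close e M N -> `|(col i N - col i M) k 0| <= e.
Proof. by move=> /(_ k i); rewrite !mxE. Qed.

Section Spans.
Context {R : realType} {d n : nat}.
Implicit Types (V : 'M[R]_(d, n)) (S : set 'I_n).

Definition spans V S : Prop :=
  forall u, (forall i, S i -> dotcv u (col i V) = 0) -> u = 0.

Lemma spansP V S : spans V S -> exists B : 'M[R]_(n, d), forall x,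
  x = \sum_(i | `[< S i >]) (B *m x) i 0 *: col i V.
Proof.
move=> spV.
pose M : 'M[R]_(d, n) := \matrix_(k, i) (if `[< S i >] then V k i else 0).
have /row_freeP[B MB] : row_free M.
  rewrite -kermx_eq0; apply/eqP/row_matrixP => k; rewrite row0.
  have : row k (kermx M) *m M = 0 by rewrite -row_mul mulmx_ker row0.
  set u := row k _ => uM; rewrite -[u]trmxK (spV u^T) ?trmx0// => i Si.
  rewrite dotE; have := congr1 (fun N : 'rV_n => N 0 i) uM.
  rewrite !mxE => {2}<-; apply: eq_bigr => l _; rewrite !mxE asboolT//.
exists B => x; rewrite -[x in LHS]mul1mx -MB -mulmxA.
apply/colP => k; rewrite summxE mxE [RHS]big_mkcond/=; apply: eq_bigr => i _.
rewrite [M _ _]mxE; case: ifP => _; last by rewrite mul0r.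
by rewrite [in RHS]mxE [col _ _ _ _]mxE mulrC.
Qed.

Lemma spans_open V S : spans V S ->
  exists2 e : R, 0 < e & forall V', mx_close e V V' -> spans V' S.
Proof.
move=> spV; have [B VB] := spansP spV.
pose K : R := \sum_i \sum_k `|B i k|.
have K0 : 0 <= K by rewrite sumr_ge0// => i _; rewrite sumr_ge0.
have K1 : 0 < 1 + K by rewrite ltr_pwDl.
have e0 : 0 < (2 * (1 + K))^-1 by rewrite invr_gt0 mulr_gt0.
exists (2 * (1 + K))^-1 => // V' VV' u hu; apply: norm1_eq0.
set e := (2 * (1 + K))^-1 in e0 VV'.
suff h : norm1 u <= norm1 u / 2.
  by apply/le_anti; rewrite norm1_ge0 andbT; lra.
rewrite -{1}dot_sgcv [X in dotcv u X]VB dot_sumr.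
apply: (@le_trans _ _ (\sum_i (\sum_k `|B i k|) * (norm1 u * e))); last first.
  rewrite -mulr_suml -/K mulrCA ler_wpM2l ?norm1_ge0// /e.
  by rewrite ler_pdivrMr ?mulr_gt0//; lra.
rewrite big_mkcond /=; apply: ler_sum => i _; case: ifP => [/asboolP Si|_]; last first.
  by rewrite !mulr_ge0 ?sumr_ge0 ?norm1_ge0 ?(ltW e0).
rewrite dotZr; apply: le_trans (ler_norm _) _; rewrite normrM ler_pM//.
  rewrite mxE; apply: le_trans (ler_norm_sum _ _ _) _; apply: ler_sum => k _.
  by rewrite normrM ler_piMr// sgcv_le1.
have -> : dotcv u (col i V) = - dotcv u (col i V' - col i V).
  by rewrite dotBr hu// sub0r opprK.
by rewrite normrN; apply: dot_le_norm1 => k; exact: mx_close_col.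
Qed.

End Spans.

Lemma fin_pos_lb (R : realType) (I : finType) (f : I -> R) :
  exists g : R, [/\ 0 < g, g <= 1 & forall i, 0 < f i -> g <= f i].
Proof.
exists (\big[Num.min/1]_(i | 0 < f i) f i); split.
- by apply: (big_ind (fun x : R => 0 < x)) => // x y x0 y0; rewrite lt_min x0.
- exact: bigmin_le_id.
- by move=> i fi; apply: bigmin_le_cond.
Qed.

Section HullPerturbation.
Context {R : realType} {d n m : nat}.
Variables (V : 'M[R]_(d, n)) (A : 'M[R]_(d, m)).
Hypothesis VA : conv_cols V = ineq_set A.

(** Functionals bounded on a perturbation of the polytope are bounded: the
    polytope contains a ball around the origin. *)
Lemma valid_bound : exists2 r : R, 0 < r & forall V' c b, mx_close r V V' ->
  (forall i, dotcv c (col i V') <= b) -> norm1 c * r <= b.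
Proof.
pose K : R := \sum_j norm1 (col j A).
have K0 : 0 <= K by apply: sumr_ge0 => j _; exact: norm1_ge0.
have K1 : 0 < 1 + K by rewrite ltr_pwDl.
pose r := ((1 + K)^-1) / 2.
have r0 : 0 < r by rewrite divr_gt0 ?invr_gt0.
exists r => // V' c b VV' hc.
have : ineq_set A ((1 + K)^-1 *: sgcv c).
  rewrite ineqE => j; rewrite dotZr mulrC ler_pdivrMr// mul1r.
  apply: le_trans (ler_norm _) _.
  apply: le_trans (dot_le_norm1 (e := 1) _ _) _; first exact: sgcv_le1.
  rewrite mulr1 (le_trans (_ : _ <= K)) ?lerDr// /K (bigD1 j)//= lerDl.
  by apply: sumr_ge0 => i _; exact: norm1_ge0.
rewrite -VA => /conv_colsP[mu [mu0 mu1 E]].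
have : dotcv c ((1 + K)^-1 *: sgcv c) <= b + norm1 c * r.
  rewrite E dot_sumr -[leRHS]mul1r -mu1 mulr_suml.
  apply: ler_sum => i _; rewrite dotZr ler_wpM2l//.
  rewrite -[leLHS](subrK (dotcv c (col i V'))) addrC lerD ?hc// -dotBr.
  apply: le_trans (ler_norm _) _; apply: dot_le_norm1 => k.
  by have := VV' k i; rewrite !mxE distrC.
rewrite dotZr dot_sgcv /r; lra.
Qed.

(** A functional [c] that is valid for [V'] is almost valid for [V], so it is
    almost a convex combination of the [a_j], one of which has a coefficient
    bounded away from zero.  A vertex off that facet has a value of [c]
    bounded away from 1. *)
Lemma tight_in_facet : exists2 e : R, 0 < e & forall V' c, mx_close e V V' ->
  (forall i, dotcv c (col i V') <= 1) ->
  (exists i, dotcv c (col i V') = 1) ->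
  exists j, forall i, dotcv c (col i V') = 1 -> dotcv (col j A) (col i V) = 1.
Proof.
have [r r0 rP] := valid_bound.
have [g [g0 g1 gP]] := fin_pos_lb
  (fun ij : 'I_n * 'I_m => 1 - dotcv (col ij.2 A) (col ij.1 V)).
(* [h] bounds the change of [c] at the vertices.  If every facet missed a tight
   vertex, all [m] coefficients would be at most [2 h / g < 1 / (2 m)], but
   their sum is at least [1 - h]. *)
pose h := g / (4 * (m%:R + 1)).
have m0 : 0 <= m%:R :> R by [].
have h0 : 0 < h by rewrite divr_gt0// mulr_gt0// ltr_wpDl.
have hg : h * (4 * (m%:R + 1)) = g.
  by rewrite divfK// gt_eqF// mulr_gt0// ltr_wpDl.
have h1 : h <= 1 / 4.
  have : 0 <= h * m%:R by rewrite mulr_ge0// ltW.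
  lra.
exists (r * h); first exact: mulr_gt0.
move=> V' c VV' hc [i0 ti0].
have VV'r : mx_close r V V'.
  move=> i j; apply: le_trans (VV' i j) _; rewrite ler_piMr ?(ltW r0)//; lra.
have cr := rP _ _ _ VV'r hc.
have cV i : `|dotcv c (col i V') - dotcv c (col i V)| <= h.
  rewrite -dotBr; apply: (@le_trans _ _ (norm1 c * (r * h))).
    by apply: dot_le_norm1 => k; exact: mx_close_col.
  by rewrite mulrA -[leRHS]mul1r ler_wpM2r// ltW.
have [x|mu [mu0 cE mub]] := @polar_ineq R d m A c (1 + h).
  rewrite -VA => /conv_colsP[nu [nu0 nu1 ->]].
  rewrite dot_sumr -[leRHS]mul1r -nu1 mulr_suml; apply: ler_sum => i _.
  rewrite dotZr ler_wpM2l//; have := hc i; have := cV i; rewrite ler_distl; lra.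
have aV j i : dotcv (col j A) (col i V) <= 1.
  by move: j; apply/ineqE; rewrite -VA; exact: conv_cols_col.
have cVE i : dotcv c (col i V) = \sum_j mu j * dotcv (col j A) (col i V).
  by rewrite cE dot_suml; under eq_bigr do rewrite dotZl.
have tcV i : dotcv c (col i V') = 1 -> 1 - h <= dotcv c (col i V).
  by move=> ti; have := cV i; rewrite ti ler_distl; lra.
apply: contrapT => /forallNP nj.
have muj j : mu j * g <= 2 * h.
  have /existsNP[i /not_implyP[ti aji]] := nj j.
  have gij : g <= 1 - dotcv (col j A) (col i V).
    apply: (gP (i, j)) => /=; rewrite subr_gt0 lt_neqAle aV andbT.
    exact/eqP.
  have := tcV _ ti; rewrite cVE (bigD1 j)//=.
  move: mub; rewrite (bigD1 j)//=.
  have : \sum_(k | k != j) mu k * dotcv (col k A) (col i V) <=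
         \sum_(k | k != j) mu k.
    by apply: ler_sum => k _; rewrite ler_piMr.
  have : mu j * g <= mu j * (1 - dotcv (col j A) (col i V)).
    by rewrite ler_wpM2l.
  rewrite mulrBr mulr1; lra.
have S1 : 1 - h <= \sum_j mu j.
  apply: le_trans (tcV _ ti0) _; rewrite cVE; apply: ler_sum => k _.
  by rewrite ler_piMr.
have : (\sum_j mu j) * g <= m%:R * (2 * h).
  rewrite mulr_suml; apply: le_trans (ler_sum _ (fun j _ => muj j)) _.
  by rewrite big_const_ord iter_addr_0 [leRHS]mulr_natl.
have : (1 - h) * g <= (\sum_j mu j) * g by rewrite ler_wpM2r// ltW.
rewrite -{1 2}hg.
have : 0 <= h * m%:R by rewrite mulr_ge0// ltW.
have : h * (h * m%:R) <= 1 / 4 * (h * m%:R).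
  by rewrite ler_wpM2r ?mulr_ge0// ltW.
have : h * h <= 1 / 4 * h by rewrite ler_wpM2r ?(ltW h0).
nra.
Qed.

(** If [x] satisfies the perturbed inequalities but is not in the perturbed
    hull, choose a valid functional [c] with [1 < c . x] that is tight at as
    many vertices as possible.  Its tight vertices span the space, since
    otherwise [c] could be moved, without decreasing [c . x], until a further
    vertex becomes tight.  They lie on one facet [j], so [c] is [a'_j], which
    contradicts [a'_j . x <= 1]. *)
Lemma hull_open : exists2 e : R, 0 < e & forall V' A', mx_close e V V' ->
  (forall i j, dotcv (col j A') (col i V') <= 1) ->
  (forall i j, dotcv (col j A) (col i V) = 1 ->
     dotcv (col j A') (col i V') = 1) ->
  conv_cols V' = @ineq_set R d m A'.
Proof.
have [r r0 rP] := valid_bound; have [e e0 eP] := tight_in_facet.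
exists (Num.min r e); first by rewrite lt_min r0.
move=> V' A' VV' le1 inc1.
have VV'r : mx_close r V V'.
  by move=> i j; apply: le_trans (VV' i j) _; rewrite ge_min lexx.
have VV'e : mx_close e V V'.
  by move=> i j; apply: le_trans (VV' i j) _; rewrite ge_min lexx orbT.
have {}rP c b : (forall i, dotcv c (col i V') <= b) -> norm1 c * r <= b.
  exact: rP.
have {}eP c : (forall i, dotcv c (col i V') <= 1) ->
    (exists i, dotcv c (col i V') = 1) -> exists j,
    forall i, dotcv c (col i V') = 1 -> dotcv (col j A) (col i V) = 1.
  exact: eP.
have pos u : u != 0 -> exists i, 0 < dotcv u (col i V').
  move=> u0; apply: contrapT => /forallNP nu; move/negP: u0; apply.
  apply/eqP/norm1_eq0/le_anti; rewrite norm1_ge0 andbT.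
  rewrite -(pmulr_lle0 _ r0); apply: rP => i; rewrite leNgt.
  exact/negP/nu.
apply/seteqP; split => x.
  move=> /conv_colsP[mu [mu0 mu1 ->]]; apply/ineqE => j.
  rewrite dot_sumr -mu1; apply: ler_sum => i _.
  by rewrite dotZr ler_piMr.
move=> /ineqE xA'; apply: contrapT => xV'.
have [c cV' cx] : exists2 c, forall i, dotcv c (col i V') <= 1 & 1 < dotcv c x.
  pose v i : 'cV[R]_(d + 1) := col_mx (col i V') (const_mx 1).
  have [/(farkas (v := v)) [mu mu0 E]|] := pselect (forall y,
      (forall i, dotcv y (v i) <= 0) -> dotcv y (col_mx x (const_mx 1)) <= 0).
    exfalso; apply: xV'; apply/conv_colsP; exists mu; split => //.
      have := congr1 (fun x => dsubmx x ord0 ord0) E.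
      rewrite /= col_mxKd linear_sum /= summxE mxE => ->.
      by apply: eq_bigr => i _; rewrite linearZ /= col_mxKd !mxE mulr1.
    have := congr1 usubmx E; rewrite col_mxKu linear_sum /= => ->.
    by apply: eq_bigr => i _; rewrite linearZ /= col_mxKu.
  move=> /existsNP[y /not_implyP[hy /negP]]; rewrite -ltNge.
  rewrite -[y]vsubmxK; set c := usubmx y; set s := dsubmx y ord0 ord0.
  have sE : dotcv (dsubmx y) (const_mx 1) = s.
    by rewrite dotE big_ord1 [const_mx _ _ _]mxE mulr1.
  rewrite dot_col_mx sE => cxs.
  have cV' i : dotcv c (col i V') <= - s.
    by move: (hy i); rewrite /v -{1}[y]vsubmxK dot_col_mx sE; lra.
  have s0 : 0 < - s.
    have := rP _ _ cV'; have [c0|c0] := eqVneq (norm1 c) 0.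
      by rewrite c0 mul0r; move: cxs; rewrite (norm1_eq0 c0) dot0l; lra.
    have : 0 < norm1 c * r by rewrite mulr_gt0// lt_neqAle eq_sym c0 norm1_ge0.
    lra.
  exists ((- s)^-1 *: c) => [i|]; rewrite dotZl mulrC.
    by rewrite ler_pdivrMr// mul1r.
  by rewrite ltr_pdivlMr// mul1r; lra.
pose T c := [pred i | dotcv c (col i V') == 1].
suff key k : forall c, (n - #|T c| < k)%N ->
    (forall i, dotcv c (col i V') <= 1) -> ~ 1 < dotcv c x.
  exact: (key _ c (ltnSn _) cV' cx).
elim: k => // k IHk {cV' cx}c ck cV' cx.
have [sp|] := pselect (forall u,
    (forall i, dotcv c (col i V') = 1 -> dotcv u (col i V') = 0) -> u = 0).
  have x0 : x <> 0 by move=> x0; move: cx; rewrite x0 dot0r ltr10.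
  have [] := eP c cV'.
    apply: contrapT => /forallNP nt; apply: x0; apply: sp => i ti.
    by have := nt i.
  move=> j hj; have cj : c - col j A' = 0.
    by apply: sp => i ti; rewrite dotBl ti inc1 ?subrr//; exact: hj.
  by move/eqP: cj cx; rewrite subr_eq0 => /eqP ->; rewrite ltNge xA'.
move=> /existsNP[u /not_implyP[hu /eqP u0]].
wlog ux : u hu u0 / 0 <= dotcv u x.
  move=> W; have [/W|ux] := leP 0 (dotcv u x); first exact.
  apply: (W (- u)); rewrite ?oppr_eq0//; last by rewrite dotNl; lra.
  by move=> i ti; rewrite dotNl hu ?oppr0.
have [i0 ui0] := pos u u0.
pose f i := (1 - dotcv c (col i V')) / dotcv u (col i V').
have [i ui imin] := @arg_minP _ _ _ i0 (fun i => 0 < dotcv u (col i V')) f ui0.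
have fi0 : 0 <= f i by rewrite divr_ge0 ?subr_ge0// ltW.
have ti : dotcv (c + f i *: u) (col i V') = 1.
  by rewrite dotDl dotZl /f divfK ?subrKC// gt_eqF.
apply: (IHk (c + f i *: u)); last 2 first.
- move=> k'; rewrite dotDl dotZl; have [uk|uk] := leP (dotcv u (col k' V')) 0.
    by have := mulr_ge0_le0 fi0 uk; have := cV' k'; lra.
  have : f i * dotcv u (col k' V') <= f k' * dotcv u (col k' V').
    by rewrite ler_wpM2r ?(ltW uk)//; exact: imin.
  by rewrite [f k']/f divfK ?gt_eqF//; lra.
- rewrite dotDl dotZl; have := mulr_ge0 fi0 ux; lra.
have : (#|T c| < #|T (c + f i *: u)%R|)%N.
  apply: proper_card; apply/properP; split.
    apply/fintype.subsetP => k'; rewrite !inE => /eqP tk.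
    by rewrite dotDl dotZl hu// mulr0 addr0 tk.
  exists i; rewrite !inE; first by rewrite ti.
  by apply/negP => /eqP /hu h; move: ui; rewrite h ltxx.
have : (#|T (c + f i *: u)%R| <= n)%N by rewrite -[leqRHS]card_ord max_card.
move: ck; lia.
Qed.
End HullPerturbation.

Lemma face_cutE (R : realType) (d n m : nat) (V : 'M[R]_(d, n))
    (A : 'M[R]_(d, m)) F : conv_cols V = ineq_set A ->
  (forall i, exists j, dotcv (col j A) (col i V) <> 1) ->
  face (conv_cols V) F -> F = face_cut V A (active A F).
Proof.
move=> VA nf fF; have [F0|/set0P F0] := eqVneq F set0; last first.
  exact: face_cut_active.
have fC : face (conv_cols V) (face_cut V A (active A F)).
  by apply: face_cut_face; rewrite VA.
rewrite {1}F0; apply/esym; rewrite -subset0 => x /(face_has_col fC)[i [_ hi]].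
have [j] := nf i; apply; apply: hi => y.
by rewrite F0.
Qed.

(** * Polytopes with the same incidences *)

Section Transfer.
Context {R : realType} {d n m : nat}.
Implicit Types (V : 'M[R]_(d, n)) (A : 'M[R]_(d, m)).

(** Faces correspond to sets of facets, so this map between the faces of two
    polytopes is an isomorphism of face lattices when both have the same
    incidences. *)
Definition face_tr A V' A' (F : set 'cV[R]_d) : set 'cV[R]_d :=
  face_cut V' A' (active A F).

Definition same_incidence V A V' A' := forall i j,
  dotcv (col j A) (col i V) = 1 <-> dotcv (col j A') (col i V') = 1.

Lemma face_tr_col V A V' A' F i : conv_cols V = ineq_set A ->
  (forall i, exists j, dotcv (col j A) (col i V) <> 1) ->
  same_incidence V A V' A' -> face (conv_cols V) F ->
  face_tr A V' A' F (col i V') <-> F (col i V).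
Proof.
move=> VA nf inc fF; rewrite {2}(face_cutE VA nf fF); split => -[_ h].
  by split=> [|j /h]; [exact: conv_cols_col|rewrite /= -inc].
by split=> [|j /h]; [exact: conv_cols_col|rewrite /= inc].
Qed.

Lemma face_tr_face A V' A' F : conv_cols V' = ineq_set A' ->
  face (conv_cols V') (face_tr A V' A' F).
Proof. by move=> VA'; apply: face_cut_face; rewrite VA'. Qed.

Lemma same_incidence_sym V A V' A' :
  same_incidence V A V' A' -> same_incidence V' A' V A.
Proof. by move=> h i j; split=> /h. Qed.

Lemma face_trK V A V' A' F : conv_cols V = ineq_set A ->
  conv_cols V' = ineq_set A' ->
  (forall i, exists j, dotcv (col j A) (col i V) <> 1) ->
  same_incidence V A V' A' -> face (conv_cols V) F ->
  face_tr A' V A (face_tr A V' A' F) = F.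
Proof.
move=> VA VA' nf inc fF; have inc' := same_incidence_sym inc.
apply: (face_eq_cols (V := V)) => // [|i]; first exact: face_tr_face.
rewrite (face_tr_col _ VA' _ inc')//; first exact: face_tr_col.
  by move=> k; have [j hj] := nf k; exists j => /inc.
exact: face_tr_face.
Qed.

Lemma face_tr_sub V A V' A' F G : conv_cols V = ineq_set A ->
  conv_cols V' = ineq_set A' ->
  (forall i, exists j, dotcv (col j A) (col i V) <> 1) ->
  same_incidence V A V' A' -> face (conv_cols V) F -> face (conv_cols V) G ->
  face_tr A V' A' F `<=` face_tr A V' A' G <-> F `<=` G.
Proof.
move=> VA VA' nf inc fF fG; split => FG.
  apply: (face_sub_cols fF fG) => i.
  by move/(face_tr_col i VA nf inc fF)/FG/(face_tr_col i VA nf inc fG).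
by move=> x [Vx h]; split=> // j aj; apply: h => y /FG; exact: aj.
Qed.

Lemma face_tr_bij V A V' A' : conv_cols V = ineq_set A ->
  conv_cols V' = ineq_set A' ->
  (forall i, exists j, dotcv (col j A) (col i V) <> 1) ->
  same_incidence V A V' A' ->
  set_bij (face (conv_cols V)) (face (conv_cols V')) (face_tr A V' A').
Proof.
move=> VA VA' nf inc; split.
- by move=> F _; exact: face_tr_face.
- move=> F G /set_mem fF /set_mem fG E.
  by rewrite -(face_trK VA VA' nf inc fF) E face_trK.
- move=> G fG; exists (face_tr A' V A G); first exact: face_tr_face.
  rewrite (face_trK VA' VA)//; last exact: same_incidence_sym.
  by move=> k; have [j hj] := nf k; exists j => /inc.
Qed.

End Transfer.

(** * Affine dimension of facets *)

Section AffDim.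
Context {R : realType} {d : nat}.
Implicit Types (S F : set 'cV[R]_d).

Definition orth (a : 'cV[R]_d) : {vspace 'cV[R]_d} :=
  lker (linfun (mulmx a^T : 'cV[R]_d -> 'cV[R]_1)).

Lemma orthP a x : reflect (dotcv a x = 0) (x \in orth a).
Proof.
rewrite memv_ker lfunE /= /dotcv; apply: (iffP eqP) => [->|h].
  by rewrite mxE.
by apply/matrixP => i j; rewrite !ord1 h mxE.
Qed.

Lemma affdim_sub S F (x0 x1 : 'cV[R]_d) (U W : {vspace 'cV[R]_d}) :
  S `<=` F -> S x0 -> F x1 ->
  (forall W' : {vspace 'cV[R]_d}, (forall x, S x -> x - x0 \in W') ->
     (U <= W')%VS) ->
  (forall x, F x -> x - x1 \in W) -> (U <= W)%VS.
Proof.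
move=> SF Sx0 Fx1 Umin FW; apply: Umin => x Sx.
have -> : x - x0 = (x - x1) - (x0 - x1) by rewrite opprB addrA subrK.
by rewrite memvB// FW//; exact: SF.
Qed.

Lemma has_affdim_uniq S k l : has_affdim S k -> has_affdim S l -> k = l.
Proof.
move=> [x0 [U [Sx0 SU Umin <-]]] [x1 [W [Sx1 SW Wmin <-]]].
apply/eqP; rewrite eqn_leq !dimvS//.
  exact: (affdim_sub (F := S) _ Sx1 Sx0 Wmin SU).
exact: (affdim_sub (F := S) _ Sx0 Sx1 Umin SW).
Qed.

End AffDim.

Section FacetDim.
Context {R : realType} {d n m : nat}.
Implicit Types (V : 'M[R]_(d.+1, n)) (A : 'M[R]_(d.+1, m)).

Lemma dim_cV : \dim {:'cV[R]_d.+1} = d.+1.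
Proof. by rewrite dimvf /dim/= muln1. Qed.

Lemma spans_full V (S : set 'I_n) (W : {vspace 'cV[R]_d.+1}) : spans V S ->
  (forall i, S i -> col i V \in W) -> W = fullv.
Proof.
move=> /spansP[B VB] SW; apply/eqP; rewrite eqEsubv subvf; apply/subvP => x _.
rewrite [x]VB; apply: memv_suml => i /asboolP Si; exact/memvZ/SW.
Qed.

Lemma dim_orth_line (U : {vspace 'cV[R]_d.+1}) a x : (U <= orth a)%VS ->
  dotcv a x != 0 -> \dim (U + <[x]>) = (\dim U).+1.
Proof.
move=> /subvP Ua ax; rewrite dimv_disjoint_sum.
  rewrite dim_vline (_ : x != 0) ?addn1//.
  by apply: contraNneq ax => ->; rewrite dot0r.
apply/eqP; rewrite -subv0; apply/subvP => y.
rewrite memv_cap => /andP[/Ua/orthP ay /vlineP[k yE]].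
move: ay; rewrite yE dotZr => /eqP; rewrite mulf_eq0 (negbTE ax) orbF.
by move=> /eqP ->; rewrite scale0r mem0v.
Qed.

Lemma spans_has_affdim V (S : set 'I_n) a (F : set 'cV[R]_d.+1) : spans V S ->
  (forall i, S i -> F (col i V)) -> (forall x, F x -> dotcv a x = 1) ->
  has_affdim F d.
Proof.
move=> spV SF Fa.
have [i0 Si0] : exists i, S i.
  apply: contrapT => /forallNP nS.
  have /spV /colP /(_ 0) : forall i, S i ->
      dotcv (const_mx 1 : 'cV[R]_d.+1) (col i V) = 0 by move=> i /nS.
  by move=> /eqP; rewrite !mxE oner_eq0.
set x0 := col i0 V; have Fx0 : F x0 by exact: SF.
pose gens := [seq col i V - x0 | i <- enum 'I_n & `[< S i >]].
pose U := <<gens>>%VS.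
have genP i : S i -> col i V - x0 \in U.
  move=> Si; apply: memv_span; apply/mapP; exists i => //.
  by rewrite mem_filter mem_enum andbT; apply/asboolP.
have Ua : (U <= orth a)%VS.
  apply/span_subvP => y /mapP[i]; rewrite mem_filter => /andP[/asboolP Si _ ->].
  by apply/orthP; rewrite dotBr !Fa ?subrr//; exact: SF.
have ax0 : dotcv a x0 != 0 by rewrite Fa ?oner_eq0.
exists x0, U; split => //.
- move=> x Fx; have [B VB] := spansP spV; rewrite [x - x0]VB.
  have : \sum_(i | `[< S i >]) (B *m (x - x0)) i 0 = 0.
    have a0 : dotcv a (x - x0) = 0 by rewrite dotBr !Fa ?subrr.
    rewrite -[RHS]a0 [X in _ = dotcv a X]VB.
    rewrite dot_sumr; apply: eq_bigr => i /asboolP Si; rewrite dotZr Fa ?mulr1//.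
    exact: SF.
  move=> b0; have -> : \sum_(i | `[< S i >]) (B *m (x - x0)) i 0 *: col i V =
      \sum_(i | `[< S i >]) (B *m (x - x0)) i 0 *: (col i V - x0).
    under [RHS]eq_bigr do rewrite scalerBr.
    by rewrite sumrB -scaler_suml b0 scale0r subr0.
  by apply: memv_suml => i /asboolP Si; exact/memvZ/genP.
- move=> W FW; apply/span_subvP => y /mapP[i].
  by rewrite mem_filter => /andP[/asboolP Si _ ->]; exact/FW/SF.
- apply: succn_inj; rewrite -(dim_orth_line Ua ax0).
  rewrite (spans_full (W := (U + <[x0]>)%VS) spV) ?dim_cV//.
  move=> i Si; rewrite -[col i V](subrK x0) memv_add ?memv_line//.
  exact: genP.
Qed.

Lemma spans_has_affdim_full V (S : set 'I_n) (F : set 'cV[R]_d.+1) : spans V S ->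
  (forall i, S i -> F (col i V)) -> F 0 -> has_affdim F d.+1.
Proof.
move=> spV SF F0; exists 0, fullv; split; rewrite ?dim_cV//.
  by move=> x _; rewrite memvf.
move=> W FW; rewrite (spans_full (W := W) spV) ?subvv// => i /SF /FW.
by rewrite subr0.
Qed.

(** The linear span of a facet contains its direction space, of dimension [d],
    and a point off that space, as the affine hull of a facet [a_j . x = 1]
    misses the origin. *)
Lemma facet_spans V A j : conv_cols V = ineq_set A ->
  has_affdim (conv_cols V) d.+1 ->
  facet (conv_cols V) (conv_cols V `&` [set x | dotcv (col j A) x = 1]) ->
  spans V [set i | dotcv (col j A) (col i V) = 1].
Proof.
move=> VA dV [fF [k [dF dV']]] u hu; set F := _ `&` _ in fF dF.
have [kE] := has_affdim_uniq dV' dV; move: dF; rewrite kE {dV' kE}.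
move=> [x0 [U [Fx0 FU Umin dU]]].
have u0 x : F x -> dotcv u x = 0.
  by apply: (face_eq fF) => i [_]; exact: hu.
have Uu : (U <= orth u)%VS.
  by apply: Umin => x Fx; apply/orthP; rewrite dotBr !u0 ?subrr.
have Ua : (U <= orth (col j A))%VS.
  apply: Umin => x Fx; apply/orthP; rewrite dotBr.
  by case: Fx => _ ->; case: Fx0 => _ ->; rewrite subrr.
have x0u : x0 \in orth u by apply/orthP/u0.
have h : (U + <[x0]> <= orth u)%VS by rewrite subv_add Uu.
have : (U + <[x0]>)%VS = fullv.
  have ax0 : dotcv (col j A) x0 != 0 by case: Fx0 => _ ->; exact: oner_neq0.
  by apply/eqP; rewrite eqEdim subvf dim_cV (dim_orth_line Ua ax0) dU leqnn.
move=> E; move: h; rewrite E => /subvP/(_ u (memvf _))/orthP.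
exact: dot_eq0.
Qed.

(** A face of the dimension of a facet lies on some [a_j . x = 1], hence has the
    same direction space as that facet, and its defining functional is constant
    on the whole facet. *)
Lemma facet_cols V A (G : set 'cV[R]_d.+1) : conv_cols V = ineq_set A ->
  (forall j, has_affdim (conv_cols V `&` [set x | dotcv (col j A) x = 1]) d) ->
  has_affdim (conv_cols V) d.+1 -> facet (conv_cols V) G ->
  exists j, G = conv_cols V `&` [set x | dotcv (col j A) x = 1].
Proof.
move=> VA dF dV [fG [k [dG dV']]].
have [kE] := has_affdim_uniq dV' dV; move: dG; rewrite kE {kE}.
move=> dG; have [x0 [U [Gx0 GU Umin dU]]] := dG.
have GE : G = face_cut V A (active A G).
  by apply: face_cut_active => //; exists x0.
have [j Gj] : active A G !=set0.
  apply/set0P/negP => /eqP a0; suff GV : G = conv_cols V.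
    move: dG; rewrite GV => /has_affdim_uniq /(_ dV) /eqP.
    by rewrite eqn_leq ltnn andbF.
  by rewrite GE a0; apply/seteqP; split => [x []//|x Vx]; split.
exists j; have [x1 [W [Fx1 FW _ dW]]] := dF j.
have UW : (U <= W)%VS.
  apply: (affdim_sub _ Gx0 Fx1 Umin FW) => x Gx.
  by split; [exact: (face_sub fG)|exact: Gj].
have {}UW : U = W by apply/eqP; rewrite eqEdim UW dU dW leqnn.
have [c [b [hb GE']]] := fG.
have Gc x : G x -> dotcv c x = b by rewrite GE' => -[].
have Uc : (U <= orth c)%VS.
  by apply: Umin => x Gx; apply/orthP; rewrite dotBr !Gc ?subrr.
apply/seteqP; split => x Gx.
  by split; [exact: (face_sub fG)|exact: Gj].
rewrite GE'; split; first by case: Gx.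
have xx0 : x - x0 \in U.
  rewrite UW; have -> : x - x0 = (x - x1) - (x0 - x1) by rewrite opprB addrA subrK.
  rewrite memvB ?FW//; split; last exact: Gj.
  exact: (face_sub fG).
have /orthP := subvP Uc _ xx0; rewrite dotBr (Gc x0)// => /eqP.
by rewrite subr_eq0 => /eqP.
Qed.

End FacetDim.

(** * The realization space near a realization *)

Lemma face_cut1 (R : realType) (d n m : nat) (V : 'M[R]_(d, n))
    (A : 'M[R]_(d, m)) j :
  conv_cols V `&` [set x | dotcv (col j A) x = 1] = face_cut V A [set j].
Proof.
apply/seteqP; split => x [Vx h]; split => //; first by move=> k ->.
exact: h.
Qed.

Lemma realization_incidence (R : realType) (d n m : nat)
    (P : labeled_polytope R d n m) (VA : 'M[R]_(d, n + m)) i j :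
  realization_space P VA ->
  dotcv (col j (rsubmx VA)) (col i (lsubmx VA)) = 1 <->
  lp_facet P j (lp_vertex P i).
Proof.
move=> [_ [Q [bQ vQ fQ [phi [_ phimon phiv phif]]]]].
have [vP _ _] := lp_vertex_bij P; have [fP _ _] := lp_facet_bij P.
have [fPj _] := fP j I.
have := phimon _ _ (vP i I) fPj; rewrite phiv phif vQ fQ => h.
have -> : lp_facet P j (lp_vertex P i) <->
    [set lp_vertex P i] `<=` lp_facet P j.
  by split=> [? _ ->//|]; apply.
rewrite -h; split => [e x ->|]; first by split; [exact: conv_cols_col|].
by move=> /(_ (col i (lsubmx VA)) erefl) [].
Qed.

Section RealizationTransfer.
Context {R : realType} {d n m : nat}.
Variable P : labeled_polytope R d.+1 n m.

(** Among pairs [(V, A)] that describe the same polytope by vertices and by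
    inequalities, realizing [P] depends on the incidences only, together with
    the nondegeneracy of the facets. *)
Lemma realization_transfer (VA : 'M[R]_(d.+1, n + m)) (V' : 'M[R]_(d.+1, n))
    (A' : 'M[R]_(d.+1, m)) :
  realization_space P VA ->
  (forall i, exists j, ~ lp_facet P j (lp_vertex P i)) ->
  conv_cols V' = ineq_set A' ->
  same_incidence (lsubmx VA) (rsubmx VA) V' A' ->
  (forall j, spans V' [set i | lp_facet P j (lp_vertex P i)]) ->
  realization_space P (row_mx V' A').
Proof.
move=> hVA nfP VA' inc sp'.
have incP i j := realization_incidence i j hVA.
have incP' i j : dotcv (col j A') (col i V') = 1 <-> lp_facet P j (lp_vertex P i).
  by rewrite -incP; split=> /inc.
move: hVA incP inc; rewrite /realization_space /=.
move: (lsubmx VA) (rsubmx VA) => V A.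
move=> [VAe [Q [bQ vQ fQ [phi [phib phimon phiv phif]]]]] incP inc.
have nf i : exists j, dotcv (col j A) (col i V) <> 1.
  by have [j hj] := nfP i; exists j => /incP.
have {vQ}vQ : lp_vertex Q = fun i => col i V by apply/funext.
have {fQ}fQ : lp_facet Q =
    fun j => conv_cols V `&` [set x | dotcv (col j A) x = 1] by apply/funext.
have := lp_facet_bij Q; rewrite bQ fQ => -[fQ1 fQ2 _].
have := lp_vertex_bij Q; rewrite bQ vQ => -[vQ1 vQ2 _].
have vinj i k : col i V = col k V -> i = k by apply: vQ2; rewrite inE.
pose tr := face_tr A V' A'.
have trv i : tr [set col i V] = [set col i V'].
  have fi := vQ1 i I; apply: face_set1; first exact: face_tr_face.
    exact/(face_tr_col i VAe nf inc fi).
  by move=> k /(face_tr_col k VAe nf inc fi) /vinj.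
have face_facet j : face (conv_cols V')
    (conv_cols V' `&` [set x | dotcv (col j A') x = 1]).
  by rewrite face_cut1; apply: face_cut_face; rewrite VA'.
have trf j : tr (conv_cols V `&` [set x | dotcv (col j A) x = 1]) =
    conv_cols V' `&` [set x | dotcv (col j A') x = 1].
  have [fj _] := fQ1 j I.
  apply: (face_eq_cols (V := V')) => // [|i]; first exact: face_tr_face.
  rewrite /tr (face_tr_col i VAe nf inc fj); split => -[_ h].
    by split; [exact: conv_cols_col|apply/inc].
  by split; [exact: conv_cols_col|apply/inc].
have dimF j : has_affdim
    (conv_cols V' `&` [set x | dotcv (col j A') x = 1]) d.
  apply: (spans_has_affdim (a := col j A') (sp' j)) => [i /= ij|x []//].
  by split; [exact: conv_cols_col|apply/incP'].
have dimV : has_affdim (conv_cols V') d.+1.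
  have := lp_dim Q; rewrite bQ => -[x0 [_ [/conv_colsP[mu [mu0 mu1 _]] _ _ _]]].
  have [i _] := sum1_pos mu0 mu1; have [l hl] := nf i.
  apply: (spans_has_affdim_full (sp' l)) => [k _|]; first exact: conv_cols_col.
  by rewrite VA' ineqE => k; rewrite dot0r ler01.
have vbij : set_bij [set: 'I_n] (vertex (conv_cols V')) (fun i => col i V').
  split=> [i _|i k _ _ e|y fy].
  - by rewrite /vertex -trv; exact: face_tr_face.
  - have fi := vQ1 i I; apply/esym/vinj.
    apply: (iffLR (face_tr_col k VAe nf inc fi)).
    by rewrite -/tr trv /= e.
  - have [i ix] := face_has_col fy (erefl y).
    by exists i.
have fbij : set_bij [set: 'I_m] (facet (conv_cols V'))
    (fun j => conv_cols V' `&` [set x | dotcv (col j A') x = 1]).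
  split=> [l _|l k _ _ e|G].
  - by split; [exact: face_facet|exists d; split; [exact: dimF|]].
  - apply: fQ2; rewrite ?inE//; have [fj _] := fQ1 l I; have [fk _] := fQ1 k I.
    by rewrite -(face_trK VAe VA' nf inc fj) -/tr trf e -trf face_trK.
  - by move=> /(facet_cols VA' dimF dimV)[l ->]; exists l.
have polV : is_polytope (conv_cols V') by exists n, V'.
split; rewrite row_mxKl row_mxKr; first by [].
exists (LabeledPolytope polV dimV vbij fbij); split => //=.
exists (tr \o phi); split => /=.
- apply: set_bij_comp phib _; rewrite bQ; exact: face_tr_bij.
- move=> F G fF fG; have [fphi _ _] := phib; rewrite bQ in fphi.
  rewrite -(phimon F G)//; exact: (face_tr_sub VAe VA' nf inc (fphi _ fF) (fphi _ fG)).
- by move=> i; rewrite phiv vQ trv.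
- by move=> j; rewrite phif fQ trf.
Qed.

End RealizationTransfer.

Lemma mx_close_near (R : realType) (a b : nat) (M : 'M[R]_(a, b)) e : 0 < e ->
  \forall N \near M, mx_close e M N.
Proof.
move=> e0; apply/nbhs_ballP; exists e => //= N [_ MN] i j.
by apply/ltW; have := MN i j; rewrite -ball_normE /= distrC.
Qed.

Lemma cvg_sum_fin (R : realType) (T : Type) (F : set_system T) {FF : Filter F}
    (I : finType) (f : I -> T -> R) (l : I -> R) :
  (forall i, f i x @[x --> F] --> l i) ->
  \sum_i f i x @[x --> F] --> \sum_i l i.
Proof. by move=> h; apply: cvg_big => //; exact: add_continuous. Qed.

Lemma dot_col_continuous (R : realType) (d n m : nat) (i : 'I_n) (j : 'I_m) :
  continuous (fun M : 'M[R]_(d, n + m) =>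
    dotcv (col j (rsubmx M)) (col i (lsubmx M))).
Proof.
rewrite (_ : (fun M => _) =
    fun M : 'M[R]_(d, n + m) => \sum_k M k (rshift n j) * M k (lshift m i)); last first.
  by apply/funext => M; rewrite dotE; apply: eq_bigr => k _; rewrite !mxE.
move=> M; apply: (@cvg_sum_fin _ _ (nbhs M)) => k.
by apply: cvgM; exact: coord_continuous.
Qed.

Lemma realization_vertex (R : realType) (d n m : nat)
    (P : labeled_polytope R d n m) (VA : 'M[R]_(d, n + m)) i :
  realization_space P VA ->
  face (conv_cols (lsubmx VA)) [set col i (lsubmx VA)].
Proof.
move=> [_ [Q [bQ vQ _ _]]]; have := lp_vertex_bij Q; rewrite bQ => -[+ _ _].
by move=> /(_ i I); rewrite vQ.
Qed.

Lemma realization_facet_spans (R : realType) (d n m : nat)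
    (P : labeled_polytope R d.+1 n m) (VA : 'M[R]_(d.+1, n + m)) j :
  realization_space P VA ->
  spans (lsubmx VA) [set i | lp_facet P j (lp_vertex P i)].
Proof.
move=> hVA; have [VAe [Q [bQ vQ fQ _]]] := hVA.
have dQ : has_affdim (conv_cols (lsubmx VA)) d.+1 by rewrite -bQ; exact: lp_dim.
have := lp_facet_bij Q; rewrite bQ => -[/(_ j I) + _ _]; rewrite fQ => fj u hu.
by apply: (facet_spans VAe dQ fj) => i /(realization_incidence i j hVA); exact: hu.
Qed.

(** All the other conditions on a realization are open: the strict inequalities
    at the pairs that are not incident, the dimension of the facets
    ([spans_open]) and, given the incidences, the equality of the convex hull
    and the set of solutions of the inequalities ([hull_open]). *)
Theorem realization_near (R : realType) (d n m : nat)
    (P : labeled_polytope R d.+1 n m) (VA : 'M[R]_(d.+1, n + m)) :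
  realization_space P VA ->
  (forall i, exists j, ~ lp_facet P j (lp_vertex P i)) ->
  \forall VA' \near VA,
    (forall i j, lp_facet P j (lp_vertex P i) ->
       dotcv (col j (rsubmx VA')) (col i (lsubmx VA')) = 1) ->
    realization_space P VA'.
Proof.
move=> hVA nf.
have incP i j := realization_incidence i j hVA.
have [VAe _] := hVA.
have le1 i j : dotcv (col j (rsubmx VA)) (col i (lsubmx VA)) <= 1.
  by move: j; apply/ineqE; rewrite -VAe; exact: conv_cols_col.
have spF j := realization_facet_spans (j := j) hVA.
have [e0 e0_gt0 e0P] := hull_open VAe.
have [e1 e1_gt0 e1P] : exists2 e1 : R, 0 < e1 & forall j V',
    mx_close e1 (lsubmx VA) V' -> spans V' [set i | lp_facet P j (lp_vertex P i)].
  have /choice[g gP] : forall j, exists e : R, 0 < e /\ forall V',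
      mx_close e (lsubmx VA) V' ->
      spans V' [set i | lp_facet P j (lp_vertex P i)].
    by move=> j; have [e ? ?] := spans_open (spF j); exists e.
  have [e1 [e1_gt0 _ e1P]] := fin_pos_lb g.
  exists e1 => // j V' VV'; apply: (gP j).2 => i k.
  by apply: le_trans (VV' i k) _; apply: e1P; exact: (gP j).1.
have strict : \forall VA' \near VA, forall ij : 'I_n * 'I_m,
    ~ lp_facet P ij.2 (lp_vertex P ij.1) ->
    dotcv (col ij.2 (rsubmx VA')) (col ij.1 (lsubmx VA')) < 1.
  apply: (filter_forall (f := fun (ij : 'I_n * 'I_m) (M : 'M[R]_(d.+1, n + m)) =>
    ~ lp_facet P ij.2 (lp_vertex P ij.1) ->
    dotcv (col ij.2 (rsubmx M)) (col ij.1 (lsubmx M)) < 1) (F := nbhs VA)) => -[i j] /=.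
  have [h|h] := pselect (lp_facet P j (lp_vertex P i)).
    by near=> M => /(_ h).
  near=> M => _; near: M; apply: cvgr_lt; first exact: dot_col_continuous.
  by rewrite lt_neqAle le1 andbT; apply/eqP => /incP.
near=> VA' => hinc.
have sub e : mx_close e VA VA' -> mx_close e (lsubmx VA) (lsubmx VA').
  by move=> h i k; rewrite !mxE; exact: h.
have st' : forall ij : 'I_n * 'I_m, ~ lp_facet P ij.2 (lp_vertex P ij.1) ->
    dotcv (col ij.2 (rsubmx VA')) (col ij.1 (lsubmx VA')) < 1.
  by near: VA'.
have st i j := st' (i, j).
have inc : same_incidence (lsubmx VA) (rsubmx VA) (lsubmx VA') (rsubmx VA').
  move=> i j; rewrite incP; split; first exact: hinc.
  by move=> e; apply: contrapT => /st; rewrite e ltxx.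
rewrite -(hsubmxK VA'); apply: (realization_transfer hVA nf _ inc).
- apply: e0P => [|i j|i j /inc//].
    by apply: sub; near: VA'; exact: mx_close_near.
  have [/hinc ->//|/st/ltW//] := pselect (lp_facet P j (lp_vertex P i)).
- by move=> j; apply: e1P; apply: sub; near: VA'; exact: mx_close_near.
Unshelve. all: by end_near. Qed.

(** * Tangent vectors of submanifolds *)

Definition tangent_curve (R : realType) (E : normedModType R) (M : set E)
    (p u : E) (c : R -> E) : Prop :=
  [/\ c 0 = p, is_derive (0 : R) (1 : R) c u & \forall t \near (0 : R), M (c t)].

Lemma is_derive1_diff (R : realType) (E : normedModType R) (c : R -> E) u :
  is_derive (0 : R) (1 : R) c u -> differentiable c 0 /\ 'd c 0 1 = u.
Proof.
move=> cu; have dc : differentiable c 0 by apply/derivable1_diffP; exact: ex_derive.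
by split => //; rewrite -deriveE// derive_val.
Qed.

Lemma near0_derive_eq0 (R : realType) (h : R -> R) :
  (\forall t \near (0 : R), h t = 0) -> 'D_1 h (0 : R) = 0.
Proof.
move=> h0; rewrite (@near_eq_derive _ _ _ _ (cst 0)) ?derive_cst ?oner_eq0//.
Qed.

Lemma diff_coord (R : realType) (m n : nat) (M : 'M[R]_(m, n)) i j N :
  'd (fun N : 'M[R]_(m, n) => N i j : R) M N = N i j.
Proof.
have @f : {linear 'M[R]_(m, n) -> R}.
  by exists (fun N : 'M[R]_(_, _) => N i j); do 2![eexists]; do ?[constructor];
     rewrite ?mxE// => ? *; rewrite ?mxE//; move=> ?; rewrite !mxE.
rewrite (_ : (fun _ => _) = f) // (@diff_lin _ _ _ f)//.
exact: coord_continuous.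
Qed.

Section SmoothCone.
Context {R : realType} {a b : nat}.
Notation mx := 'M[R]_(a, b).
Variables (M : set mx) (p : mx).

(** In a slice chart [f] velocities in [M] become vectors of the coordinate
    subspace; the segment in the direction of the image of [u1 + u2] stays in
    that subspace and is pulled back to [M] by the inverse chart. *)
Lemma smooth_at_tangent_add (c1 c2 : R -> mx) u1 u2 : M p -> smooth_at M p ->
  tangent_curve M p u1 c1 -> tangent_curve M p u2 c2 ->
  exists c, tangent_curve M p (u1 + u2) c.
Proof.
move=> Mp [N [k [Np [_ emb]]]] tc1 tc2.
have [U [W [f [g [oU Up oW [sf sg fU gW fK] slice]]]]] :=
  emb p (conj Mp (nbhs_singleton Np)).
have nU : nbhs p U by exact: open_nbhs_nbhs.
have [Dff _] := sf 1%N; have df : differentiable f p by exact: Dff.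
have Wfp : W (f p) by rewrite -fU; exists p.
have nW : nbhs (f p) W by exact: open_nbhs_nbhs.
have [Dgg _] := sg 1%N; have dg : differentiable g (f p) by exact: Dgg.
have gfp : g (f p) = p by rewrite fK ?inE.
have tan c u : tangent_curve M p u c ->
    forall i : 'I_(a * b), (k <= i)%N -> ('d f p u) 0 i = 0.
  move=> [c0 /is_derive1_diff[dc <-] Mc] i ki.
  pose h t := (f (c t)) 0 i.
  have dfc : differentiable (f \o c) 0.
    by apply: differentiable_comp => //; rewrite c0.
  have <- : 'D_1 h 0 = ('d f p ('d c 0 1)) 0 i.
    have dco : differentiable (fun N : 'rV[R]_(a * b) => N 0 i) ((f \o c) 0).
      exact: differentiable_coord.
    have -> : h = (fun N : 'rV[R]_(a * b) => N 0 i) \o (f \o c) by [].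
    rewrite deriveE; last exact: differentiable_comp.
    rewrite diff_comp//= diff_comp ?c0//=.
    by rewrite diff_coord.
  apply: near0_derive_eq0.
  have cc : {for 0, continuous c} by exact: differentiable_continuous.
  have nU' : \forall t \near (0 : R), U (c t) by apply: cc; rewrite c0.
  have nN' : \forall t \near (0 : R), N (c t) by apply: cc; rewrite c0.
  near=> t; rewrite /h.
  have : (coord_slice k `&` W) (f (c t)).
    rewrite -slice; exists (c t) => //; split; last by near: t.
    by split; near: t.
  by move=> [/(_ i ki)].
pose z := 'd f p (u1 + u2).
have z0 (i : 'I_(a * b)) : (k <= i)%N -> z 0 i = 0.
  by move=> ki; rewrite /z linearD mxE (tan _ _ tc1)// (tan _ _ tc2)// addr0.
have fp0 (i : 'I_(a * b)) : (k <= i)%N -> (f p) 0 i = 0.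
  have : (coord_slice k `&` W) (f p).
    rewrite -slice; exists p => //; split => //; split => //.
    exact: nbhs_singleton.
  by move=> [h _]; exact: h.
exists (fun s => g (f p + s *: z)); split.
- by rewrite scale0r addr0.
- pose l (s : R) := f p + s *: z.
  have [dl dlE] : differentiable l 0 /\ 'd l 0 = ( *:%R^~ z) :> (R -> _).
    have il : is_diff (0 : R) l (0 + ( *:%R^~ z)).
      rewrite (_ : l = cst (f p) + ( *:%R^~ z)); last exact/funext.
      exact: is_diffD.
    by split; [exact: ex_diff|rewrite diff_val add0r].
  have l0 : l 0 = f p by rewrite /l scale0r addr0.
  have dgl : differentiable (g \o l) 0.
    by apply: differentiable_comp => //; rewrite l0.
  have Dgl : is_derive (0 : R) (1 : R) (g \o l) ('d (g \o l) 0 1).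
    by apply: DeriveDef; [exact: diff_derivable|rewrite deriveE].
  suff <- : 'd (g \o l) 0 1 = u1 + u2 by [].
  rewrite diff_comp ?l0//= dlE scale1r /z -[LHS]/(('d g (f p) \o 'd f p) _).
  rewrite -diff_comp// -deriveE; last exact: differentiable_comp.
  rewrite (@near_eq_derive _ _ _ _ id) ?derive_id//.
  by near=> x; apply: fK; rewrite inE; near: x.
- have lc : {for (0 : R), continuous (fun s : R => f p + s *: z)}.
    apply: cvgD; first exact: cvg_cst.
    by apply: cvgZr_tmp; exact: cvg_id.
  have nW' : \forall s \near (0 : R), W (f p + s *: z).
    by apply: lc; rewrite /= scale0r addr0.
  near=> s.
  have : (coord_slice k `&` W) (f p + s *: z).
    split; last by near: s.
    by move=> i ki; rewrite !mxE fp0// z0// mulr0 addr0.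
  by rewrite -slice => -[x [[Mx Nx] Ux] <-]; rewrite fK ?inE.
Unshelve. all: by end_near. Qed.

(** A form that vanishes at the chords of [M] from [p] vanishes at their limit
    directions. *)
Lemma tangent_quadratic (q : mx -> R) c u : continuous q ->
  (forall s x, q (s *: x) = s ^+ 2 * q x) ->
  (forall x, M x -> q (x - p) = 0) -> tangent_curve M p u c -> q u = 0.
Proof.
move=> qc qh qM [c0 cu Mc].
have cvu : h^-1 *: ((c \o shift 0) (h *: 1) - c 0) @[h --> 0^'] --> u.
  by rewrite -(@derive_val _ _ _ _ _ _ _ cu); exact: (@ex_derive _ _ _ _ _ _ _ cu).
have qcv : q (h^-1 *: ((c \o shift 0) (h *: 1) - c 0)) @[h --> 0^'] --> q u.
  by apply: cvg_comp cvu _; exact: qc.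
rewrite -(cvg_lim _ qcv)//; apply: lim_near_cst => //; near=> h.
rewrite qh c0 qM ?mulr0//= addr0 [_ *: _]mulr1; near: h; exact: nbhs_dnbhs.
Unshelve. all: by end_near. Qed.

Lemma smooth_at_quadratic (q : mx -> R) c1 c2 u1 u2 : M p -> smooth_at M p ->
  continuous q -> (forall s x, q (s *: x) = s ^+ 2 * q x) ->
  (forall x, M x -> q (x - p) = 0) ->
  tangent_curve M p u1 c1 -> tangent_curve M p u2 c2 -> q (u1 + u2) = 0.
Proof.
move=> Mp sM qc qh qM tc1 tc2.
have [c tc] := smooth_at_tangent_add Mp sM tc1 tc2.
exact: (tangent_quadratic qc qh qM tc).
Qed.

End SmoothCone.

(** * The standard 24-cell *)

(** Vectors with integer coordinates are lists, so that the finitely many facts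
    needed about the 24-cell can be decided by computation. *)
Definition dotz (u v : seq int) : int :=
  u`_0 * v`_0 + (u`_1 * v`_1 + (u`_2 * v`_2 + u`_3 * v`_3)).

(** The vertices are the integer vectors of squared norm 2.  Those of squared
    norm 4 are twice the facet normals, which are the vectors [+- e_i] and
    [(+- 1, +- 1, +- 1, +- 1) / 2]. *)
Definition int_vectors (norm : int) : seq (seq int) :=
  let box := [:: -2; -1; 0; 1; 2] in
  let pairs := [seq [:: a; b] | a <- box, b <- box] in
  [seq v <- [seq p ++ q | p <- pairs, q <- pairs] | dotz v v == norm].

Definition zroots : seq (seq int) := Eval vm_compute in int_vectors 2.
Definition znormals : seq (seq int) := Eval vm_compute in int_vectors 4.
Definition zroot (i : nat) : seq int := nth [::] zroots i.
Definition znormal (j : nat) : seq int := nth [::] znormals j.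

Definition zinc (i j : nat) : bool := dotz (zroot i) (znormal j) == 2.

Definition sum24 (f : nat -> int) : int := foldr +%R 0 (map f (iota 0 24)).

Lemma sum24E f : sum24 f = \sum_(i < 24) f i.
Proof. by rewrite /sum24 foldrE big_map -(big_mkord xpredT) /index_iota subn0. Qed.

Lemma all_ordP (n : nat) (P : nat -> bool) :
  all P (iota 0 n) -> forall i : 'I_n, P i.
Proof. by move=> /allP h i; apply: h; rewrite mem_iota ltn_ord. Qed.

Lemma all2_ordP (n m : nat) (P : nat -> nat -> bool) :
  all (fun i => all (P i) (iota 0 m)) (iota 0 n) ->
  forall (i : 'I_n) (j : 'I_m), P i j.
Proof. by move=> h i; apply: all_ordP; exact: (all_ordP h). Qed.

Section Std.
Context {R : realType}.

Definition intcv (v : seq int) : 'cV[R]_4 := \col_(k < 4) (v`_k)%:~R.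

Lemma dot_intcv u v : dotcv (intcv u) (intcv v) = (dotz u v)%:~R.
Proof.
by rewrite dotE !big_ord_recl big_ord0 !mxE addr0 -!intrM -!intrD.
Qed.

Definition rootv (i : nat) : 'cV[R]_4 := intcv (zroot i).
Definition normalv (j : nat) : 'cV[R]_4 := intcv (znormal j).

Definition root_mx : 'M[R]_(4, 24) := \matrix_(k < 4, i < 24) ((zroot i)`_k)%:~R.

Lemma col_root_mx i : col i root_mx = rootv i.
Proof. by apply/colP => k; rewrite !mxE. Qed.

Definition zpattern (i j : nat) (s t : bool) : seq int :=
  mkseq (fun k => if k == i then (-1) ^+ s else if k == j then (-1) ^+ t else 0) 4.

Lemma intcv_pattern (i j : 'I_4) (s t : bool) : (i < j)%N ->
  intcv (zpattern i j s t) =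
  (-1) ^+ s *: delta_mx i ord0 + (-1) ^+ t *: delta_mx j ord0.
Proof.
move=> ij; apply/colP => k; rewrite mxE nth_mkseq// !mxE !andbT.
have [->|ki] := eqVneq k i.
  by rewrite eqxx -val_eqE /= (ltn_eqF ij) mulr1 mulr0 addr0 rmorph_sign.
rewrite -val_eqE/= in ki; rewrite (negbTE ki) mulr0 add0r -val_eqE.
by case: eqP => _; rewrite ?mulr1 ?mulr0// rmorph_sign.
Qed.

Lemma cell24E : @cell24 R = conv_cols root_mx.
Proof.
rewrite /cell24 /conv_cols; congr convex_hull; apply/seteqP; split => x.
  move=> [i [j [s [t [ij ->]]]]]; rewrite -intcv_pattern//.
  have zr : zpattern i j s t \in zroots.
    apply: (implyP _ ij); move: i j {ij}; apply: (@all2_ordP 4 4 (fun i j =>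
      (i < j)%N ==> (zpattern i j s t \in zroots))).
    by case: s t => -[]; vm_compute.
  have [r r24 <-] := nthP [::] zr.
  by exists (Ordinal r24) => //; rewrite col_root_mx.
move=> [r _ <-]; rewrite col_root_mx.
have /all_ordP /(_ r) : all (fun r => has (fun i => has (fun j => has (fun s =>
    has (fun t => (i < j)%N && (zroot r == zpattern i j s t))
      [:: true; false]) [:: true; false]) (iota 0 4)) (iota 0 4)) (iota 0 24).
  by vm_compute.
move=> /hasP[i i4] /hasP[j j4] /hasP[s _] /hasP[t _] /andP[ij /eqP rE].
rewrite !mem_iota in i4 j4.
exists (Ordinal i4), (Ordinal j4), s, t; split => //.
by rewrite -intcv_pattern//= -rE.
Qed.

Lemma dot_root_normal i j :
  dotcv (normalv j) (rootv i) = (dotz (zroot i) (znormal j))%:~R.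
Proof. by rewrite dotC dot_intcv. Qed.

Lemma root_normal_le2 (i j : 'I_24) : dotcv (normalv j) (rootv i) <= 2.
Proof.
rewrite dot_root_normal (_ : 2 = 2%:~R)// ler_int; move: i j.
by apply: (@all2_ordP 24 24 (fun i j => dotz (zroot i) (znormal j) <= 2)); vm_compute.
Qed.

Lemma root_normal_eq2 (i j : 'I_24) : dotcv (normalv j) (rootv i) = 2 <-> zinc i j.
Proof.
rewrite dot_root_normal /zinc (_ : 2 = 2%:~R)//; split => [/intr_inj ->//|].
by move=> /eqP ->.
Qed.

(** The six vertices [w] of the facet of normal [n / 2] satisfy
    [sum_w (3 w - n) w^T = 6 I]. *)
Lemma root_spans (j : 'I_24) (u : 'cV[R]_4) :
  (forall i : 'I_24, zinc i j -> dotcv u (rootv i) = 0) -> u = 0.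
Proof.
move=> hu.
have K (k l : 'I_4) : \sum_(i < 24)
    (if zinc i j then (3 * (zroot i)`_k - (znormal j)`_k) * (zroot i)`_l else 0) =
    (if k == l then 6 else 0).
  rewrite -(sum24E (fun i => if zinc i j then
    (3 * (zroot i)`_k - (znormal j)`_k) * (zroot i)`_l else 0)).
  apply/eqP; move: k l; apply: (@all2_ordP 4 4 (fun k l =>
    sum24 (fun i => if zinc i j then (3 * (zroot i)`_k - (znormal j)`_k) *
       (zroot i)`_l else 0) == (if k == l then 6 else 0))).
  move: j {hu}; apply: (@all_ordP 24 (fun j => all (fun k => all (fun l =>
    sum24 (fun i => if zinc i j then (3 * (zroot i)`_k - (znormal j)`_k) *
       (zroot i)`_l else 0) == (if k == l then 6 else 0)) (iota 0 4)) (iota 0 4))).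
  by vm_compute.
apply/colP => k; rewrite mxE.
have : \sum_l u l 0 * (if k == l then 6 else 0 : int)%:~R = 0.
  under eq_bigr => l _ do rewrite -K rmorph_sum mulr_sumr.
  rewrite exchange_big big1// => i _.
  have [/hu|_] /= := boolP (zinc i j); last by apply: big1 => l _; rewrite mulr0.
  rewrite dotE => ui; set c := _ - _.
  rewrite -[RHS](mulr0 c%:~R) -[X in _ = _ * X]ui mulr_sumr.
  by apply: eq_bigr => l _; rewrite intrM mxE mulrCA.
rewrite (bigD1 k)//= eqxx big1 => [|l]; last first.
  by rewrite eq_sym => /negbTE ->; rewrite mulr0.
by rewrite addr0 => /eqP; rewrite mulf_eq0 intr_eq0 orbF => /eqP.
Qed.


Lemma cell24_root (i : 'I_24) : @cell24 R (rootv i).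
Proof. by rewrite cell24E -col_root_mx; exact: conv_cols_col. Qed.

Definition std_facet (j : nat) : set 'cV[R]_4 :=
  @cell24 R `&` [set x | dotcv (normalv j) x = 2].

Lemma std_facet_root (i j : 'I_24) : std_facet j (rootv i) <-> zinc i j.
Proof.
rewrite -root_normal_eq2; split => [[]//|h].
by split; [exact: cell24_root|].
Qed.

Lemma std_facetP (j : 'I_24) : has_affdim (@cell24 R) 4 ->
  facet (@cell24 R) (std_facet j).
Proof.
move=> d4; split.
  exists (normalv j), 2; split => // x; rewrite cell24E => /conv_colsP.
  move=> [mu [mu0 mu1 ->]]; rewrite dot_sumr -[leRHS]mul1r -[X in X * 2]mu1 mulr_suml.
  apply: ler_sum => i _; rewrite dotZr ler_wpM2l// col_root_mx.
  exact: root_normal_le2.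
exists 3; split => //.
apply: (@spans_has_affdim R 3 24 root_mx [set i | zinc i j] (2^-1 *: normalv j)).
- by move=> u hu; apply: (@root_spans j) => i ij; rewrite -col_root_mx; exact: hu.
- by move=> i ij; rewrite col_root_mx; exact/std_facet_root.
- by move=> x [_ /= h]; rewrite dotZl h mulVf.
Qed.

Lemma std_facet_inj (j l : 'I_24) : std_facet j = std_facet l -> j = l.
Proof.
move=> e; apply/val_inj/eqP.
have := @all2_ordP 24 24 (fun j l => all (fun i => zinc i j == zinc i l)
  (iota 0 24) ==> (j == l)); move/(_ _ j l)/implyP; apply; first by vm_compute.
apply/allP => i; rewrite mem_iota => /andP[_ i24].
have h := std_facet_root (Ordinal i24).
have [/(h j)|nj] := boolP (zinc i j); first by rewrite e => /h ->.
by apply/eqP/esym/negP => /(h l); rewrite -e => /(h j); exact/negP.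
Qed.

(** [P] has exactly 24 facets, and the 24 facets [std_facet j] are distinct, so
    that there are no others. *)
Lemma cell24_labels (P : labeled_polytope R 4 24 24) : lp_body P = @cell24 R ->
  exists s t : 'I_24 -> 'I_24, [/\ bijective s, bijective t &
    forall i j, lp_facet P j (lp_vertex P i) <-> zinc (s i) (t j)].
Proof.
move=> bP; have d4 := lp_dim P; rewrite bP in d4.
have [vP vinj _] := lp_vertex_bij P; have [_ finj fsurj] := lp_facet_bij P.
rewrite bP in vP fsurj.
have /choice[s sP] i : exists r : 'I_24, lp_vertex P i = rootv r.
  have := vP i I; rewrite cell24E => fi.
  by have [r] := face_has_col fi erefl; exists r; rewrite -col_root_mx.
have /choice[t tP] (j : 'I_24) : exists l : 'I_24, lp_facet P l = std_facet j.
  by have [l _ e] := fsurj _ (std_facetP j d4); exists l.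
have sI : injective s.
  by move=> i k e; apply: vinj; rewrite ?inE// !sP e.
have tI : injective t.
  by move=> i k e; apply: std_facet_inj; rewrite -!tP e.
have [t' tK t'K] := injF_bij tI.
exists s, t'; split; [exact: injF_bij|by exists t|] => i j.
by rewrite sP -{1}(t'K j) tP std_facet_root.
Qed.

Lemma root_not_all (i : 'I_24) : exists j : 'I_24, ~ zinc i j.
Proof.
have : has (fun j => ~~ zinc i j) (iota 0 24).
  by move: i; apply: (@all_ordP 24 (fun i => has (fun j => ~~ zinc i j) (iota 0 24)));
    vm_compute.
move=> /hasP[j]; rewrite mem_iota => /andP[_ j24] /negP ij.
by exists (Ordinal j24).
Qed.

End Std.

(** * Edges of regular polytopes *)

Section Edges.
Context {R : realType} {d : nat}.
Implicit Types (P : set 'cV[R]_d) (x y : 'cV[R]_d).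

Lemma face_chain_flag P C0 : face_chain P C0 -> exists2 C, flag P C & C0 `<=` C.
Proof.
move=> ch0; pose S := [set C | face_chain P (C `|` C0)].
have [F FS totF|A [SA Amax]] := @Zorn_bigcup _ S.
  split=> [G [[C FC CG]|]|G H]; last 2 first.
  - exact: ch0.1.
  - move=> [[C FC CG]|G0] [[D FD DH]|H0].
    + have [CD|DC] := totF _ _ FC FD.
        by apply: (FS _ FD).2; left => //; exact: CD.
      by apply: (FS _ FC).2; left => //; exact: DC.
    + by apply: (FS _ FC).2; [left|right].
    + by apply: (FS _ FD).2; [right|left].
    + exact: ch0.2.
  by apply: (FS _ FC).1; left.
exists (A `|` C0); last by move=> G; right.
split => // C' chC' AC'; apply/seteqP; split => // G C'G.
have [AG|nAG] := pselect (A G); first by left.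
exfalso; apply: (Amax C'); last first.
  by rewrite /S /= (setUidl (subset_trans _ AC'))// => H; right.
split; last by move=> C'A; apply: nAG; exact: C'A.
by move=> H AH; apply: AC'; left.
Qed.

Definition seg x y : set 'cV[R]_d :=
  [set z | exists t : R, [/\ 0 <= t, t <= 1 & z = x + t *: (y - x)]].

Definition is_edge P x y : Prop :=
  [/\ x <> y, face P [set x] & face P (seg x y)].

Lemma seg_l x y : seg x y x.
Proof. by exists 0; rewrite lexx ler01 scale0r addr0. Qed.

Lemma seg_r x y : seg x y y.
Proof. by exists 1; rewrite lexx ler01 scale1r addrC subrK. Qed.

Lemma seg_sub_face P F x y z : face P F -> seg x y `<=` P -> F x -> F z ->
  seg x y z -> z <> x -> seg x y `<=` F.
Proof.
move=> [c [b [_ ->]]] segP [_ /= cx] [_ /= cz] [t [_ _ zE]] zx w sw.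
split; first exact: segP.
have cyx : dotcv c (y - x) = 0.
  move: cz; rewrite zE dotDr dotZr cx => /eqP.
  rewrite -subr_eq0 addrAC subrr add0r mulf_eq0 => /orP[/eqP t0|/eqP//].
  by case: zx; rewrite zE t0 scale0r addr0.
by case: sw => s [_ _ ->] /=; rewrite dotDr dotZr cyx mulr0 addr0.
Qed.

(** An isometry between flags through the two edges maps [x] to [x'], as a chain
    contains only one singleton.  The edge [x' y'] is the image of some face of
    the first flag, which contains [x] and another point, hence the edge [x y].
    So [y] is mapped into the edge [x' y']. *)
Lemma regular_edge_le P x y x' y' : regular_polytope P ->
  is_edge P x y -> is_edge P x' y' ->
  dotcv (y - x) (y - x) <= dotcv (y' - x') (y' - x').
Proof.
move=> [_ reg] [xy fx fxy] [xy' fx' fxy'].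
have chain u v : face P [set u] -> face P (seg u v) ->
    exists C, [/\ flag P C, C [set u] & C (seg u v)].
  move=> fu fuv.
  have [|C flC sC] :=
    @face_chain_flag P [set F | F = [set u] \/ F = seg u v].
    split=> [F [->|->]//|F G [->|->] [->|->]]; try by left.
    - by left=> z ->; exact: seg_l.
    - by right=> z ->; exact: seg_l.
  by exists C; split => //; apply: sC; [left|right].
have [C [flC Cx Cxy]] := chain _ _ fx fxy.
have [C' [flC' C'x C'xy]] := chain _ _ fx' fxy'.
have [f [fiso _ fC]] := reg _ _ flC flC'.
have [[_ totC] _] := flC; have [[_ totC'] _] := flC'.
have fxx' : f x = x'.
  have C'fx : C' (f @` [set x]) by rewrite -fC; exists [set x].
  rewrite image_set1 in C'fx.
  by have [/(_ (f x) erefl)|/(_ x' erefl)] := totC' _ _ C'fx C'x.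
have [X CX fX] : exists2 X, C X & f @` X = seg x' y'.
  by move: C'xy; rewrite -fC => -[X CX <-]; exists X.
have [z Xz fz] : (f @` X) y' by rewrite fX; exact: seg_r.
have zx : z <> x by move=> zx; apply: xy'; rewrite -fz zx.
have segP : seg x y `<=` P by have [c [b [_ ->]]] := fxy; move=> ? [].
have Xx : X x.
  have [/(_ z Xz)//|/(_ x erefl)//] := totC _ _ CX Cx.
have sX : seg x y `<=` X.
  have [Xs|//] := totC _ _ CX Cxy.
  apply: (seg_sub_face _ segP Xx Xz _ zx); last exact: Xs.
  by have [[/(_ X CX)]] := flC.
have : seg x' y' (f y) by rewrite -fX; exists y => //; apply: sX; exact: seg_r.
move=> [t [t0 t1 fyE]]; rewrite -fiso fyE fxx' addrAC subrr add0r dotZl dotZr.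
rewrite mulrA ler_piMl ?dot_ge0//.
by rewrite mulr_ile1.
Qed.

Lemma regular_edge P x y x' y' : regular_polytope P ->
  is_edge P x y -> is_edge P x' y' ->
  dotcv (y - x) (y - x) = dotcv (y' - x') (y' - x').
Proof. by move=> rP e e'; apply/le_anti; rewrite !(regular_edge_le rP). Qed.

End Edges.

Lemma conv_edge (R : realType) (d n m : nat) (V : 'M[R]_(d, n)) (A : 'M[R]_(d, m))
    i k : conv_cols V = ineq_set A -> face (conv_cols V) [set col i V] ->
  col i V <> col k V ->
  (forall l, (forall j, dotcv (col j A) (col i V) = 1 ->
     dotcv (col j A) (col k V) = 1 -> dotcv (col j A) (col l V) = 1) ->
     l = i \/ l = k) ->
  is_edge (conv_cols V) (col i V) (col k V).
Proof.
move=> VA fi ik hJ; split => //.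
pose J := [set j | dotcv (col j A) (col i V) = 1 /\ dotcv (col j A) (col k V) = 1].
have fF : face (conv_cols V) (face_cut V A J) by apply: face_cut_face; rewrite VA.
suff -> : seg (col i V) (col k V) = face_cut V A J by [].
apply/seteqP; split => [z [t [t0 t1 ->]]|z Fz].
  split.
    rewrite VA; apply/ineqE => j; rewrite dotDr dotZr dotBr.
    have Vle l : dotcv (col j A) (col l V) <= 1.
      by move: j; apply/ineqE; rewrite -VA; exact: conv_cols_col.
    by have := Vle i; have := Vle k; nra.
  by move=> j [ji jk]; rewrite /= dotDr dotZr dotBr ji jk subrr mulr0 addr0.
have /conv_colsP[mu [mu0 mu1 zE]] := face_sub fF Fz.
have mul l : l != i -> l != k -> mu l = 0.
  move=> li lk; apply/eqP; apply: contraT => ml.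
  have : face_cut V A J (col l V).
    apply: (face_col fF mu0 mu1); rewrite -?zE//.
    by rewrite lt_neqAle eq_sym ml mu0.
  move=> [_ hl]; have [|le|le] := hJ l; first by move=> j ji jk; exact: hl.
    by rewrite le eqxx in li.
  by rewrite le eqxx in lk.
have ki : k != i by apply/eqP => ki; apply: ik; rewrite ki.
move: mu1; rewrite (bigD1 i)//= (bigD1 k)//= big1 ?addr0.
  2: by move=> l /andP[]; exact: mul.
move=> mu1.
exists (mu k); split => //; first by rewrite -mu1 lerDr.
rewrite zE (bigD1 i)//= (bigD1 k)//= big1 ?addr0 => [|l /andP[li lk]]; last first.
  by rewrite mul// scale0r.
by rewrite -(addrK (mu k) (mu i)) mu1 scalerBl scale1r scalerBr addrA addrAC.
Qed.

Lemma orthogonal_frame (R : realType) (d : nat) (v : 'I_d -> 'cV[R]_d) s :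
  (forall i, v i <> 0) -> (forall i k, i != k -> dotcv (v i) (v k) = 0) ->
  (forall i, dotcv (v i) s = 0) -> s = 0.
Proof.
move=> v0 vv vs; pose M : 'M[R]_d := \matrix_(i, k) v i k 0.
have Mx (x : 'cV[R]_d) i : (M *m x) i 0 = dotcv (v i) x.
  by rewrite dotE mxE; apply: eq_bigr => k _; rewrite mxE.
have Mu : M \in unitmx.
  have : \det (M *m M^T) != 0.
    rewrite (_ : M *m M^T = diag_mx (\row_i dotcv (v i) (v i))).
      rewrite det_diag; apply/prodf_neq0 => i _; rewrite mxE.
      by apply/eqP => /dot_eq0; exact: v0.
    apply/matrixP => i k; rewrite [RHS]mxE [in RHS]mxE.
    have -> : (M *m M^T) i k = dotcv (v i) (v k).
      by rewrite dotE mxE; apply: eq_bigr => l _; rewrite !mxE.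
    have [->|ik] := eqVneq i k; first by rewrite mulr1n.
    by rewrite mulr0n vv.
  by rewrite det_mulmx det_tr mulf_eq0 orbb unitmxE unitfE.
rewrite -[s](mulKmx Mu) (_ : M *m s = 0) ?mulmx0//.
by apply/colP => i; rewrite Mx vs mxE.
Qed.

(** The diagonals [x - x'], [y - y'] and [z - z'] are orthogonal to each other
    and to the normal [a] of the hyperplane of the octahedron, and
    [x + x' - y - y'] is orthogonal to all four. *)
Lemma octahedron_midpoints (R : realType) (x x' y y' z z' a : 'cV[R]_4) (l : R) :
  (forall u w, (u, w) \in [:: (x, y); (x, y'); (x', y); (x', y'); (x, z); (x, z');
     (x', z); (x', z'); (y, z); (y, z'); (y', z); (y', z')] ->
     dotcv (w - u) (w - u) = l) ->
  (forall u, u \in [:: x; x'; y; y'; z; z'] -> dotcv a u = 1) ->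
  x <> x' -> y <> y' -> z <> z' -> x + x' = y + y'.
Proof.
move=> hl ha xx' yy' zz'.
have eql u w : (u, w) \in [:: (x, y); (x, y'); (x', y); (x', y'); (x, z); (x, z');
     (x', z); (x', z'); (y, z); (y, z'); (y', z); (y', z')] ->
    dotcv w w - 2 * dotcv u w + dotcv u u = l.
  move=> /hl <-; rewrite dotBl !dotBr (dotC w u); ring.
have exy := eql x y; have exy' := eql x y'; have ex'y := eql x' y.
have ex'y' := eql x' y'; have exz := eql x z; have exz' := eql x z'.
have ex'z := eql x' z; have ex'z' := eql x' z'; have eyz := eql y z.
have eyz' := eql y z'; have ey'z := eql y' z; have ey'z' := eql y' z'.
rewrite !inE !eqxx !orbT /= in exy exy' ex'y ex'y' exz exz' ex'z ex'z' eyz eyz'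
  ey'z ey'z'.
have ax := ha x; have ax' := ha x'; have ay := ha y; have ay' := ha y'.
have az := ha z; have az' := ha z'.
rewrite !inE !eqxx !orbT /= in ax ax' ay ay' az az'.
move: (exy isT) (exy' isT) (ex'y isT) (ex'y' isT) (exz isT) (exz' isT) (ex'z isT)
  (ex'z' isT) (eyz isT) (eyz' isT) (ey'z isT) (ey'z' isT).
move: (ax isT) (ax' isT) (ay isT) (ay' isT) (az isT) (az' isT).
move=> {exy exy' ex'y ex'y' exz exz' ex'z ex'z' eyz eyz' ey'z ey'z'}.
move=> {ax ax' ay ay' az az' eql hl ha} ax ax' ay ay' az az'.
move=> exy exy' ex'y ex'y' exz exz' ex'z ex'z' eyz eyz' ey'z ey'z'.
apply/eqP; rewrite -subr_eq0; apply/eqP.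
pose v (i : 'I_4) := nth 0 [:: x - x'; y - y'; z - z'; a] i.
have a0 : a <> 0.
  by move=> a0; move: ax; rewrite a0 dot0l => /eqP; rewrite eq_sym oner_eq0.
apply: (@orthogonal_frame R 4 v).
- by case=> -[|[|[|[|//]]]] i4; rewrite /v //= => /eqP; rewrite subr_eq0 => /eqP.
- case=> -[|[|[|[|//]]]] i4; case=> -[|[|[|[|//]]]] k4; rewrite /v //= => _;
  rewrite ?dotBr ?dotBl ?(dotC y x) ?(dotC y' x) ?(dotC y x') ?(dotC y' x')
   ?(dotC z x) ?(dotC z x') ?(dotC z' x) ?(dotC z' x')
   ?(dotC z y) ?(dotC z y') ?(dotC z' y)
   ?(dotC z' y') ?(dotC _ a); lra.
- case=> -[|[|[|[|//]]]] i4; rewrite /v /= ?dotBr ?dotDr ?dotBl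
   ?(dotC y x) ?(dotC y' x) ?(dotC y x') ?(dotC y' x')
   ?(dotC z x) ?(dotC z x') ?(dotC z' x) ?(dotC z' x')
   ?(dotC z y) ?(dotC z y') ?(dotC z' y)
   ?(dotC z' y') ?(dotC x' x) ?(dotC y' y); lra.
Qed.

(** * Regular realizations are affinely standard *)

(** Two pairs of opposite vertices [(t, t')] and [(q, q')] of a facet; each such
    quadruple stands for the relation [U t + U t' = U q + U q'] *)
Record oct_quad := OctQuad
  { oq_facet : nat; oq_t : nat; oq_t' : nat; oq_q : nat; oq_q' : nat }.

Definition facet_verts (j : nat) : seq nat := [seq i <- iota 0 24 | zinc i j].

Definition opp_pairs (j : nat) : seq (nat * nat) :=
  [seq p <- [seq (i, k) | i <- facet_verts j, k <- facet_verts j]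
    | dotz (zroot p.1) (zroot p.2) == 0].

Definition oct_quads : seq oct_quad := Eval vm_compute in
  flatten [seq [seq OctQuad j p.1 p.2 q.1 q.2 |
    p <- opp_pairs j, q <- opp_pairs j] | j <- iota 0 24].

Definition oq_coef (Q : oct_quad) (u : nat) : int :=
  (oq_t Q == u)%:Z + (oq_t' Q == u)%:Z - (oq_q Q == u)%:Z - (oq_q' Q == u)%:Z.

(** Weights of a linear combination of the relations that expresses the vertex
    [r] affinely by all 24 vertices.  They depend only on the position of [r]
    relative to the facet and the vertex [t], by symmetry.  The numbers 38, 6
    and -7 solve the equations for the coefficients of the vertices at each
    of the five distances from [r]. *)
Definition oq_weight (r : nat) (Q : oct_quad) : int :=
  let a := dotz (zroot r) (znormal (oq_facet Q)) in
  let b := dotz (zroot r) (zroot (oq_t Q)) in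
  if a == 2 then (if b == 2 then 38 else 0)
  else if a == -2 then (if b == -2 then 6 else 0)
  else (if b == 0 then -7 else 0).

Definition oq_comb (r u : nat) : int :=
  foldr +%R 0 [seq oq_weight r Q * oq_coef Q u | Q <- oct_quads].

Lemma oq_combE : all (fun r => all (fun u => oq_comb r u ==
  48 * (24 * (r == u)%:Z - 1 - 2 * dotz (zroot r) (zroot u))) (iota 0 24)) (iota 0 24).
Proof. by vm_compute. Qed.

Lemma oq_bound : all (fun Q => [&& (oq_facet Q < 24)%N, (oq_t Q < 24)%N,
  (oq_t' Q < 24)%N, (oq_q Q < 24)%N & (oq_q' Q < 24)%N]) oct_quads.
Proof. by vm_compute. Qed.

Definition adj (i k : nat) : bool := dotz (zroot i) (zroot k) == 1.

(** The third diagonal [z z'] of the facet of two distinct diagonals, as needed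
    to apply [octahedron_midpoints]. *)
Lemma oq_octahedron : all (fun Q =>
  let: OctQuad j t t' q q' := Q in
  [|| (t == q) && (t' == q'), (t == q') && (t' == q) |
   has (fun z => has (fun z' => all (fun p => adj p.1 p.2) [:: (t, q); (t, q');
    (t', q); (t', q'); (t, z); (t, z'); (t', z); (t', z');
    (q, z); (q, z'); (q', z); (q', z')] && 
    all (fun i => zinc i j) [:: t; t'; q; q'; z; z'] &&
    uniq [:: t; t'; q; q'; z; z']) (facet_verts j)) (facet_verts j)]) oct_quads.
Proof. by vm_compute. Qed.

Lemma sum_all_eq0 (T : Type) (W : nmodType) (s : seq T) (f : T -> W) :
  all (fun x => f x == 0) s -> \sum_(x <- s) f x = 0.
Proof.
elim: s => [|x s IHs]; first by rewrite big_nil.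
by move=> /= /andP[/eqP fx /IHs]; rewrite big_cons fx add0r.
Qed.

Lemma eq_big_all (T : Type) (W : nmodType) (s : seq T) (f g : T -> W) :
  all (fun x => f x == g x) s -> \sum_(x <- s) f x = \sum_(x <- s) g x.
Proof.
elim: s => [|x s IHs]; first by rewrite !big_nil.
by move=> /= /andP[/eqP fx /IHs E]; rewrite !big_cons fx E.
Qed.

(** The relations between opposite vertices determine each [h r] from the mean
    of [h] and its first moments: the solutions are the affine functions of the
    standard vertices. *)
Lemma oct_relations_affine (R : realType) (W : lmodType R) (h : nat -> W) :
  all (fun Q => h (oq_t Q) + h (oq_t' Q) == h (oq_q Q) + h (oq_q' Q)) oct_quads ->
  forall r : 'I_24, 24 *: h r =
    \sum_(u < 24) h u + 2 *: \sum_(u < 24) (dotz (zroot r) (zroot u))%:~R *: h u.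
Proof.
move=> hrel r.
have delta i : (i < 24)%N -> h i = \sum_(u < 24) (i == u)%:R *: h u.
  move=> i24; rewrite (bigD1 (Ordinal i24))//= eqxx scale1r big1 ?addr0// => u.
  by rewrite -val_eqE eq_sym /= => /negbTE ->; rewrite scale0r.
have E0 : \sum_(Q <- oct_quads) (oq_weight r Q)%:~R *:
    (h (oq_t Q) + h (oq_t' Q) - h (oq_q Q) - h (oq_q' Q)) = 0.
  apply: sum_all_eq0; apply: sub_all hrel => Q /eqP ->.
  by rewrite -addrA -opprD addrN scaler0.
have E1 : \sum_(Q <- oct_quads) (oq_weight r Q)%:~R *:
    (h (oq_t Q) + h (oq_t' Q) - h (oq_q Q) - h (oq_q' Q)) =
    \sum_(Q <- oct_quads) \sum_(u < 24) (oq_weight r Q * oq_coef Q u)%:~R *: h u.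
  apply: eq_big_all; apply: sub_all oq_bound => Q /and5P[_ t t' q q'].
  apply/eqP; rewrite (delta _ t) (delta _ t') (delta _ q) (delta _ q').
  rewrite -big_split -!sumrB scaler_sumr; apply: eq_bigr => u _ /=.
  by rewrite -scalerDl -!scalerBl scalerA intrM /oq_coef !rmorphB rmorphD.
move: E1; rewrite {}E0 exchange_big /= => /esym E.
have : 48%:R *: (24 *: h r - \sum_(u < 24) h u -
    2 *: \sum_(u < 24) (dotz (zroot r) (zroot u))%:~R *: h u) = 0.
  rewrite -[RHS]E (delta r)// !scaler_sumr -!sumrB scaler_sumr.
  apply: eq_bigr => u _; rewrite -scaler_suml -rmorph_sum /=.
  have -> : \sum_(Q <- oct_quads) oq_weight r Q * oq_coef Q u = oq_comb r u.
    by rewrite /oq_comb foldrE big_map.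
  rewrite (eqP (all2_ordP oq_combE r u)) !scalerA -[X in _ - X - _]scale1r.
  rewrite -!scalerBl scalerA; congr (_ *: _).
  by rewrite !rmorphM !rmorphB !rmorphM /= !mulrBr; congr (_ - _ - _); lra.
move=> /eqP; rewrite scaler_eq0 pnatr_eq0 /= -addrA -opprD subr_eq0.
by move/eqP.
Qed.

Lemma dotz_gt_size i (s : seq (seq int)) v :
  dotz (nth [::] s i) v != 0 -> (i < size s)%N.
Proof.
apply: contraNT; rewrite -leqNgt => ?; rewrite nth_default// /dotz /=.
by rewrite !mul0r.
Qed.

Lemma adj_lt24 i k : adj i k -> (i < 24)%N /\ (k < 24)%N.
Proof.
move=> /eqP e; split.
  by apply: (@dotz_gt_size _ zroots (zroot k)); rewrite -/(zroot i) e.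
apply: (@dotz_gt_size _ zroots (zroot i)); rewrite -/(zroot k).
by rewrite (_ : dotz _ _ = 1)// -e /dotz; lia.
Qed.

Lemma zinc_lt24 i j : zinc i j -> (i < 24)%N /\ (j < 24)%N.
Proof.
move=> /eqP e; split.
  by apply: (@dotz_gt_size _ zroots (znormal j)); rewrite -/(zroot i) e.
apply: (@dotz_gt_size _ znormals (zroot i)); rewrite -/(znormal j).
by rewrite (_ : dotz _ _ = 2)// -e /dotz; lia.
Qed.

Lemma inj_unitmx (R : fieldType) (d : nat) (M : 'M[R]_d) :
  (forall u : 'cV[R]_d, M *m u = 0 -> u = 0) -> M \in unitmx.
Proof.
move=> MI; rewrite -unitmx_tr -row_free_unit -kermx_eq0; apply/eqP/row_matrixP => k.
rewrite row0; apply: trmx_inj; rewrite trmx0; apply: MI.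
by rewrite -[X in X *m _]trmxK -trmx_mul -row_mul mulmx_ker row0 trmx0.
Qed.

Section RegularAffine.
Context {R : realType}.
Variables (V A : 'M[R]_(4, 24)).
Hypothesis VA : conv_cols V = ineq_set A.
Hypothesis inc : forall i j : 'I_24,
  dotcv (col j A) (col i V) = 1 <-> zinc i j.
Hypothesis vert : forall i, face (conv_cols V) [set col i V].
Hypothesis spF : forall j : 'I_24, spans V [set i | zinc i j].

Lemma std_col_inj (i k : 'I_24) : col i V = col k V -> i = k.
Proof.
move=> e; apply/val_inj/eqP.
have := @all2_ordP 24 24 (fun i k => all (fun j => zinc i j == zinc k j)
  (iota 0 24) ==> (i == k)); move/(_ _ i k)/implyP; apply; first by vm_compute.
apply/allP => j; rewrite mem_iota => /andP[_ j24].
have h l := inc l (Ordinal j24).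
have [/(h i)|nj] := boolP (zinc i j); first by rewrite e => /h ->.
by apply/eqP/esym/negP => /(h k); rewrite -e => /(h i); exact/negP.
Qed.

Lemma adj_is_edge (i k : 'I_24) : adj i k ->
  is_edge (conv_cols V) (col i V) (col k V).
Proof.
move=> ik; apply: (conv_edge VA (vert i)).
  move=> /std_col_inj e; move: ik; rewrite e.
  have : all (fun k => ~~ adj k k) (iota 0 24) by vm_compute.
  by move=> /all_ordP /(_ k) /negbTE ->.
move=> l hl.
have : all (fun j => zinc i j && zinc k j ==> zinc l j) (iota 0 24).
  apply/allP => j; rewrite mem_iota => /andP[_ j24]; apply/implyP => /andP[ij kj].
  by apply/(inc l (Ordinal j24)); apply: hl; apply/inc.
have := @all2_ordP 24 24 (fun i k => adj i k ==> all (fun l =>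
  all (fun j => zinc i j && zinc k j ==> zinc l j) (iota 0 24) ==>
  ((l == i) || (l == k))) (iota 0 24)); move/(_ _ i k)/implyP.
move=> /(_ _ ik) H /(implyP (all_ordP (H _) l)) H'.
have /orP[/eqP/val_inj ->|/eqP/val_inj ->] : ((l == i :> nat) || (l == k :> nat)).
  by apply: H'; vm_compute.
  by left.
by right.
Qed.

Hypothesis reg : regular_polytope (conv_cols V).

Let h (i : nat) : 'cV[R]_4 := col (inord i) V.

Lemma regular_oct_relations :
  all (fun Q => h (oq_t Q) + h (oq_t' Q) == h (oq_q Q) + h (oq_q' Q)) oct_quads.
Proof.
have [l hl] : exists l : R, forall i k, adj i k ->
    dotcv (h k - h i) (h k - h i) = l.
  exists (dotcv (h 1 - h 0) (h 1 - h 0)) => i k ik; have [i24 k24] := adj_lt24 ik.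
  by apply: (regular_edge reg); apply: adj_is_edge; rewrite !inordK.
have hA j i : zinc i j -> dotcv (col (inord j) A) (h i) = 1.
  move=> ij; apply/inc; have [i24 j24] := zinc_lt24 ij.
  by rewrite !inordK.
have hinj i k : (i < 24)%N -> (k < 24)%N -> i != k -> h i <> h k.
  by move=> i24 k24 /eqP ik /std_col_inj /(congr1 val); rewrite /= !inordK.
apply: sub_all oq_octahedron => -[j t t' q q']; lazy beta iota.
case/or3P => [/andP[/eqP -> /eqP ->]|/andP[/eqP -> /eqP ->]|].
- by [].
- by rewrite /= addrC.
move=> /hasP[z _ /hasP[z' _ /andP[/andP[adjs incs] un]]].
apply/eqP; apply: (@octahedron_midpoints R _ _ _ _ (h z) (h z') (col (inord j) A) l).
- move=> u w /(mapP (f := fun p => (h p.1, h p.2)) (s := [:: (t, q); (t, q');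
    (t', q); (t', q'); (t, z); (t, z'); (t', z); (t', z');
    (q, z); (q, z'); (q', z); (q', z')])) [[i k] ik [-> ->]].
  exact: hl (allP adjs _ ik).
- move=> u /(mapP (f := h) (s := [:: t; t'; q; q'; z; z'])) [i it ->].
  exact: hA (allP incs _ it).
all: have lt : all (fun i => (i < 24)%N) [:: t; t'; q; q'; z; z'] by
  apply: sub_all incs => i /zinc_lt24[].
all: have key a b : (a < 6)%N -> (b < 6)%N -> a != b ->
    h (nth 0%N [:: t; t'; q; q'; z; z'] a) <>
    h (nth 0%N [:: t; t'; q; q'; z; z'] b) by
  move=> a6 b6 ab; apply: hinj; [exact: (all_nthP 0%N lt)|exact: (all_nthP 0%N lt)|
    by rewrite nth_uniq].
- exact: (key 0 1)%N.
- exact: (key 2 3)%N.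
- exact: (key 4 5)%N.
Qed.

Definition bary : 'cV[R]_4 := 24^-1 *: \sum_(u < 24) col u V.

(** Over the standard vertices [sum_u w_u = 0] and [sum_u w_u w_u^T = 12 I], so
    this recovers the linear part of an affine map from the images of the
    [w_u]. *)
Definition linpart : 'M[R]_4 :=
  12^-1 *: \sum_(u < 24) col u V *m (rootv u)^T.

Lemma regular_col (i : 'I_24) : col i V = linpart *m rootv i + bary.
Proof.
have := oct_relations_affine regular_oct_relations i.
rewrite /h inord_val => /(congr1 (fun x => 24^-1 *: x)).
rewrite scalerA mulVf ?scale1r// => ->.
rewrite scalerDr addrC scalerA /bary; congr (_ + _ *: _); last first.
  by apply: eq_bigr => u _; rewrite inord_val.
rewrite /linpart -scalemxAl mulmx_suml; congr (_ *: _); first by field.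
apply: eq_bigr => u _; rewrite inord_val -mulmxA [_ *m rootv i]mx11_scalar.
rewrite mul_mx_scalar; congr (_ *: _).
by rewrite -[RHS]/(dotcv (rootv u) (rootv i)) dotC dot_intcv.
Qed.

(** A nonzero vector orthogonal to the image has the same scalar product with
    all vertices.  So it is proportional to every facet normal, which would put
    each vertex on all facets. *)
Lemma linpart_unit : linpart \in unitmx.
Proof.
rewrite -unitmx_tr; apply: inj_unitmx => u Lu; pose k := dotcv u bary.
have uV (i : 'I_24) : dotcv u (col i V) = k.
  by rewrite regular_col dotDr dotC dot_mull Lu dot0r add0r.
have ukA (j : 'I_24) : u = k *: col j A.
  apply/eqP; rewrite -subr_eq0; apply/eqP; apply: (spF (j := j)) => i ij.
  by rewrite dotBl dotZl uV (inc i j).2 ?mulr1 ?subrr.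
have [k0|k0] := eqVneq k 0; first by rewrite (ukA ord0) k0 scale0r.
have [j] := root_not_all ord0; case; apply/inc.
by apply: (mulfI k0); rewrite -dotZl -ukA uV mulr1.
Qed.

Definition facet_scale (j : 'I_24) : R := 1 - dotcv (col j A) bary.

Lemma regular_facet (j : 'I_24) :
  linpart^T *m col j A = (facet_scale j / 2) *: normalv j.
Proof.
apply/eqP; rewrite -subr_eq0; apply/eqP; apply: (@root_spans R j) => i ij.
rewrite dotBl dot_mull trmxK dotZl (root_normal_eq2 i j).2// divfK//.
by rewrite -[linpart *m _](addrK bary) -regular_col dotBr (inc i j).2 ?subrr.
Qed.

Lemma facet_scale_neq0 (j : 'I_24) : facet_scale j != 0.
Proof.
apply/eqP => k0; have := regular_facet j; rewrite k0 mul0r scale0r => La.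
have aj : col j A = 0.
  have LTu : linpart^T \in unitmx by rewrite unitmx_tr linpart_unit.
  by rewrite -[LHS](mulKmx LTu) La mulmx0.
have /all_ordP /(_ j) /hasP[i] : all (fun j => has (fun i => zinc i j) (iota 0 24))
    (iota 0 24) by vm_compute.
rewrite mem_iota => /andP[_ i24] ij.
have /eqP := (inc (Ordinal i24) j).2 ij.
by rewrite aj dot0l eq_sym oner_eq0.
Qed.

End RegularAffine.

(** * Derivatives of curves of matrices *)

Lemma cvg_mx (R : realType) (T : Type) (F : set_system T) {FF : Filter F} (a b : nat)
    (f : T -> 'M[R]_(a, b)) (l : 'M[R]_(a, b)) :
  (forall i j, f x i j @[x --> F] --> l i j) -> f x @[x --> F] --> l.
Proof.
move=> fl; apply/cvgrPdist_lt => e e0.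
have h : \forall x \near F, forall ij : 'I_a * 'I_b, `|l ij.1 ij.2 - f x ij.1 ij.2| < e.
  apply: (filter_forall (f := fun (ij : 'I_a * 'I_b) x =>
    `|l ij.1 ij.2 - f x ij.1 ij.2| < e) (F := F)) => ij.
  by move: e e0; apply/cvgrPdist_lt; exact: fl.
near=> x; rewrite [ltLHS]/Num.norm /= mx_normrE; apply/bigmax_ltP; split => // ij _.
rewrite !mxE; have H : forall ij : 'I_a * 'I_b, `|l ij.1 ij.2 - f x ij.1 ij.2| < e.
  by near: x.
exact: H.
Unshelve. all: by end_near. Qed.

Lemma is_derive_mx (R : realType) (a b : nat) (f : R -> 'M[R]_(a, b))
    (g : 'M[R]_(a, b)) :
  (forall i j, is_derive (0 : R) (1 : R) (fun t => f t i j) (g i j)) ->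
  is_derive (0 : R) (1 : R) f g.
Proof.
move=> fg.
have cv : h^-1 *: ((f \o shift 0) (h *: 1) - f 0) @[h --> 0^'] --> g.
  apply: cvg_mx => i j.
  rewrite -(@derive_val _ _ _ _ _ _ _ (fg i j)).
  have := @ex_derive _ _ _ _ _ _ _ (fg i j).
  rewrite /derivable /derive => H.
  by under eq_cvg do rewrite !mxE; exact: H.
by apply: DeriveDef; [apply/cvg_ex; exists g|exact: cvg_lim].
Qed.

Lemma is_derive_moebius (R : realType) (a b e : R) :
  is_derive (0 : R) (1 : R) (fun t => (a + t * b) / (1 + t * e)) (b - a * e).
Proof.
have lin : 1 + h * e @[h --> (0 : R)^'] --> (1 : R).
  rewrite [X in _ --> X](_ : _ = 1 + 0 * e); last by rewrite mul0r addr0.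
  by apply: cvgD; [exact: cvg_cst|apply: cvgM; [exact: nbhs_dnbhs|exact: cvg_cst]].
have ne : \forall h \near (0 : R)^', 1 + h * e != 0.
  by apply: cvgr_neq0 lin _; exact: oner_neq0.
have cv : (b - a * e) / (1 + h * e) @[h --> (0 : R)^'] --> b - a * e.
  rewrite [X in _ --> X](_ : _ = (b - a * e) * 1^-1); last by rewrite invr1 mulr1.
  by apply: cvgM; [exact: cvg_cst|apply: cvgV lin; exact: oner_neq0].
pose f t := (a + t * b) / (1 + t * e).
have {}cv : h^-1 *: ((f \o shift 0) (h *: 1) - f 0) @[h --> 0^'] --> b - a * e.
  apply: cvg_trans cv; apply: near_eq_cvg; near=> h.
  have h0 : h != 0 by near: h; exact: nbhs_dnbhs_neq.
  have he : 1 + h * e != 0 by near: h.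
  rewrite /f /GRing.scale /= !mulr1 !addr0 !mul0r !addr0.
  by field; rewrite he.
by apply: DeriveDef; [apply/cvg_ex; exists (b - a * e)|exact: cvg_lim].
Unshelve. all: by end_near. Qed.

(** * A self-stress and two deformations *)

(** The values 1, -1, 0 on the three cross-polytopes formed by the vertices,
    which are the classes of the partitions 01|23, 02|13 and 03|12 of the
    coordinates by the support of a vertex *)
Definition vsign (v : seq int) : int :=
  (v`_0 * v`_0 - v`_3 * v`_3) * (v`_1 * v`_1 - v`_2 * v`_2).
(** The values 2, -1, -1 on the three cross-polytopes formed by the normals,
    which are the coordinate vectors and the sign vectors with an even or an
    odd number of minus signs *)
Definition nsign (v : seq int) : int := if 0 \in v then 2 else -1.

Definition vweight (i j : nat) : int := if zinc i j then vsign (zroot i) else 0.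
Definition nweight (i j : nat) : int := if zinc i j then nsign (znormal j) else 0.

(** For [f = 2 / (n . n)], twice the displacement of [v] when the half-space
    [n . x > 0] is stretched by the factor 2 in the direction [n]; the doubling
    keeps the coordinates integral. *)
Definition stretch (n : seq int) (f : int) (v : seq int) : seq int :=
  mkseq (fun k => f * (Num.max 0 (dotz n v) * n`_k)) 4.

Definition dir1 : seq int := [:: 1; 0; 0; 0].
Definition dir2 : seq int := [:: -1; 1; 0; 0].

(** The conditions under which moving the vertex [w_i] by [r x_i / 2] and the
    doubled normal [n_j] by [- r / (1 + r) y_j / 2] preserves the incidences
    for all [r]: the terms of order [r] and of order [r ^ 2] vanish. *)
Definition compatible (x y : nat -> seq int) : bool :=
  all (fun i => all (fun j => zinc i j ==>
    (dotz (x i) (znormal j) == dotz (zroot i) (y j)) &&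
    (2 * dotz (x i) (znormal j) == dotz (x i) (y j))) (iota 0 24)) (iota 0 24).

Definition vel_x (n : seq int) (f : int) (i : nat) := stretch n f (zroot i).
Definition vel_y (n : seq int) (f : int) (j : nat) := stretch n f (znormal j).

Lemma compatible1 : compatible (vel_x dir1 2) (vel_y dir1 2).
Proof. by vm_compute. Qed.

Lemma compatible2 : compatible (vel_x dir2 1) (vel_y dir2 1).
Proof. by vm_compute. Qed.

Definition addv (u v : seq int) : seq int := mkseq (fun k => u`_k + v`_k) 4.

Definition sum_x i := addv (vel_x dir1 2 i) (vel_x dir2 1 i).
Definition sum_y j := addv (vel_y dir1 2 j) (vel_y dir2 1 j).

Lemma nweight_normals : all (fun i => all (fun k =>
  sum24 (fun j => nweight i j * (znormal j)`_k) == 0) (iota 0 4)) (iota 0 24).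
Proof. by vm_compute. Qed.

Lemma vweight_roots : all (fun j => all (fun k =>
  sum24 (fun i => vweight i j * (zroot i)`_k) == 0) (iota 0 4)) (iota 0 24).
Proof. by vm_compute. Qed.

Lemma vweight_sum : all (fun j => sum24 (fun i => vweight i j) == 0) (iota 0 24).
Proof. by vm_compute. Qed.

Lemma vweight_sum_x : all (fun j =>
  sum24 (fun i => vweight i j * dotz (sum_x i) (znormal j)) == 0) (iota 0 24).
Proof. by vm_compute. Qed.

(** Up to a factor, the value of the quadratic form of the self-stress at the
    sum of the two velocities *)
Definition obstruction : int := sum24 (fun i => sum24 (fun j =>
  vweight i j * nsign (znormal j) * dotz (sum_x i) (sum_y j))).

Lemma obstruction_neq0 : obstruction != 0.
Proof. by vm_compute. Qed.

Lemma is_derive_affine (R : realType) (a b : R) :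
  is_derive (0 : R) (1 : R) (fun t => a + t * b) b.
Proof.
have := is_derive_moebius a b 0; rewrite mulr0 subr0; congr (is_derive _ _ _ _).
by apply/funext => t; rewrite mulr0 addr0 divr1.
Qed.

Lemma intcv_addv (R : realType) u v :
  intcv (addv u v) = intcv u + intcv v :> 'cV[R]_4.
Proof. by apply/colP => k; rewrite !mxE nth_mkseq// rmorphD. Qed.

Lemma sum24_label (R : realType) (s : 'I_24 -> 'I_24) (f : nat -> int) :
  bijective s -> sum24 f == 0 -> \sum_i (f (s i))%:~R = 0 :> R.
Proof.
move=> bs /eqP f0.
rewrite -(reindex s (P := xpredT) (F := fun i : 'I_24 => (f i)%:~R : R)) /=.
  by rewrite -rmorph_sum -sum24E f0.
exact: onW_bij.
Qed.

Lemma sum24_intcv (R : realType) (s : 'I_24 -> 'I_24) (f : nat -> int)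
    (v : nat -> seq int) : bijective s ->
  all (fun k => sum24 (fun i => f i * (v i)`_k) == 0) (iota 0 4) ->
  \sum_i (f (s i))%:~R *: intcv (v (s i)) = 0 :> 'cV[R]_4.
Proof.
move=> bs h; apply/colP => k; rewrite summxE mxE.
rewrite -[RHS](sum24_label R bs (all_ordP h k)).
by apply: eq_bigr => i _; rewrite !mxE rmorphM.
Qed.

Section Deformation.
Context {R : realType}.
Variables (P : labeled_polytope R 4 24 24) (VA : 'M[R]_(4, 24 + 24)).
Variables (s t : 'I_24 -> 'I_24) (L : 'M[R]_4) (c : 'cV[R]_4).
Let V := lsubmx VA.
Let A := rsubmx VA.
Let kappa j : R := 1 - dotcv (col j A) c.
Hypotheses (bs : bijective s) (bt : bijective t).
Hypothesis incst : forall i j, lp_facet P j (lp_vertex P i) <-> zinc (s i) (t j).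
Hypothesis hVA : realization_space P VA.
Hypothesis Lu : L \in unitmx.
Hypothesis VE : forall i, col i V = L *m rootv (s i) + c.
Hypothesis AE : forall j, L^T *m col j A = (kappa j / 2) *: normalv (t j).
Hypothesis kappa0 : forall j, kappa j != 0.

Let LTu : L^T \in unitmx. Proof. by rewrite unitmx_tr. Qed.

Let nonfull i : exists j, ~ lp_facet P j (lp_vertex P i).
Proof.
have [t' tK t'K] := bt; have [j hj] := root_not_all (s i).
by exists (t' j) => /incst; rewrite t'K.
Qed.

Let AV i j : zinc (s i) (t j) -> dotcv (col j A) (col i V) = 1.
Proof. by move/incst/(realization_incidence i j hVA). Qed.

Definition vmove (x : nat -> seq int) i : 'cV[R]_4 :=
  2^-1 *: (L *m intcv (x (s i))).
Definition fmove (y : nat -> seq int) j : 'cV[R]_4 :=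
  (kappa j / 4) *: (invmx L^T *m intcv (y (t j))).

Lemma dot_A_vmove x i j :
  dotcv (col j A) (vmove x i) = kappa j / 4 * (dotz (x (s i)) (znormal (t j)))%:~R.
Proof.
by rewrite dotZr dotC dot_mull AE dotZr dot_intcv; field.
Qed.

Lemma dot_fmove_V y i j : dotcv (fmove y j) (col i V) =
  kappa j / 4 * (dotz (zroot (s i)) (y (t j)))%:~R + dotcv c (fmove y j).
Proof.
rewrite VE dotDr (dotC _ c); congr (_ + _).
by rewrite dotZl dotC dot_mull mulKVmx// dot_intcv.
Qed.

Lemma dot_fmove_vmove x y i j : dotcv (fmove y j) (vmove x i) =
  kappa j / 8 * (dotz (x (s i)) (y (t j)))%:~R.
Proof.
by rewrite dotZl dotZr dotC dot_mull mulKVmx// dot_intcv; field.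
Qed.

(** The hyperplane of the facet [j] gets the normal
    [a_j - r / (1 + r) fmove y j] and moves relative to the origin, which need
    not be the center [c] of the polytope, so that the normal has to be scaled
    by [(1 - r / (1 + r) (c . fmove y j))^-1].  Here numerator and denominator
    are multiplied by [1 + r]. *)
Definition curve (x y : nat -> seq int) (r : R) : 'M[R]_(4, 24 + 24) :=
  row_mx (\matrix_(k, i) (V k i + r * vmove x i k 0))
    (\matrix_(k, j) ((A k j + r * (A k j - fmove y j k 0)) /
                      (1 + r * (1 - dotcv c (fmove y j))))).

Definition velocity (x y : nat -> seq int) : 'M[R]_(4, 24 + 24) :=
  row_mx (\matrix_(k, i) vmove x i k 0)
    (\matrix_(k, j) (dotcv c (fmove y j) * A k j - fmove y j k 0)).

Lemma curve0 x y : curve x y 0 = VA.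
Proof.
rewrite -[RHS]hsubmxK; congr row_mx; apply/matrixP => k i; rewrite mxE !mul0r.
  by rewrite addr0.
by rewrite !addr0 divr1.
Qed.

Lemma curve_is_derive x y :
  is_derive (0 : R) (1 : R) (curve x y) (velocity x y).
Proof.
apply: is_derive_mx => k l; have [i ->|j ->] := split_ordP l.
  rewrite row_mxEl mxE (_ : (fun r => _) = fun r => V k i + r * vmove x i k 0).
    exact: is_derive_affine.
  by apply/funext => r; rewrite row_mxEl mxE.
rewrite row_mxEr mxE (_ : (fun r => _) =
  fun r => (A k j + r * (A k j - fmove y j k 0)) /
    (1 + r * (1 - dotcv c (fmove y j)))); last first.
  by apply/funext => r; rewrite row_mxEr mxE.
have -> : dotcv c (fmove y j) * A k j - fmove y j k 0 =
    (A k j - fmove y j k 0) - A k j * (1 - dotcv c (fmove y j)) by ring.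
exact: is_derive_moebius.
Qed.

Lemma curve_incidence x y r i j : compatible x y ->
  1 + r * (1 - dotcv c (fmove y j)) != 0 -> zinc (s i) (t j) ->
  dotcv (col j (rsubmx (curve x y r))) (col i (lsubmx (curve x y r))) = 1.
Proof.
move=> xy r0 ij; rewrite row_mxKl row_mxKr.
have -> : col i (\matrix_(k, i) (V k i + r * vmove x i k 0)) =
    col i V + r *: vmove x i.
  by apply/colP => k; rewrite !mxE.
have -> : col j (\matrix_(k, j) ((A k j + r * (A k j - fmove y j k 0)) /
    (1 + r * (1 - dotcv c (fmove y j))))) =
    (1 + r * (1 - dotcv c (fmove y j)))^-1 *:
      (col j A + r *: (col j A - fmove y j)).
  by apply/colP => k; rewrite !mxE mulrC.
move: (dot_A_vmove x i j) (dot_fmove_V y i j) (dot_fmove_vmove x y i j) r0.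
move: (vmove x i) (fmove y j) => X m AX mV mX r0.
rewrite dotZl dotDl dotZl !dotDr !dotZr !dotBl AV// AX mV mX.
have /implyP/(_ ij)/andP[/eqP e1 /eqP e2] := all2_ordP xy (s i) (t j).
have {}e1 := congr1 (intr : int -> R) e1.
have {}e2 := congr1 (intr : int -> R) e2.
rewrite -e1 -e2 rmorphM /=.
by rewrite -[RHS](mulVf r0); congr (_ * _); field.
Qed.

Lemma curve_tangent x y : compatible x y ->
  tangent_curve (realization_space P) VA (velocity x y) (curve x y).
Proof.
move=> xy; have dc := curve_is_derive x y; split; [exact: curve0|exact: dc|].
have [difc _] := is_derive1_diff dc.
have cc : {for 0, continuous (curve x y)} by exact: differentiable_continuous.
have nM : \forall r \near (0 : R), (forall i j, lp_facet P j (lp_vertex P i) ->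
    dotcv (col j (rsubmx (curve x y r))) (col i (lsubmx (curve x y r))) = 1) ->
    realization_space P (curve x y r).
  have := realization_near hVA nonfull; rewrite -{1}(curve0 x y).
  by move=> nVA; exact: (cc _ nVA).
have n0 : \forall r \near (0 : R), forall j, 1 + r * (1 - dotcv c (fmove y j)) != 0.
  apply: (filter_forall (f := fun j r => 1 + r * (1 - dotcv c (fmove y j)) != 0)
    (F := nbhs (0 : R))) => j.
  have : (fun r : R => 1 + r * (1 - dotcv c (fmove y j))) @ (0 : R) --> (1 : R).
    rewrite [X in _ --> X](_ : _ = 1 + 0 * (1 - dotcv c (fmove y j))).
      by apply: cvgD; [exact: cvg_cst|apply: cvgM; [exact: cvg_id|exact: cvg_cst]].
    by rewrite mul0r addr0.
  by move=> h; apply: cvgr_neq0 h _; exact: oner_neq0.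
near=> r.
have h0 : forall j, 1 + r * (1 - dotcv c (fmove y j)) != 0 by near: r.
have : (forall i j, lp_facet P j (lp_vertex P i) ->
    dotcv (col j (rsubmx (curve x y r))) (col i (lsubmx (curve x y r))) = 1) ->
    realization_space P (curve x y r) by near: r.
by apply => i j /incst; exact: curve_incidence.
Unshelve. all: by end_near. Qed.

Lemma velocity_add x y x' y' : velocity x y + velocity x' y' =
  velocity (fun i => addv (x i) (x' i)) (fun j => addv (y j) (y' j)).
Proof.
have vm i : vmove (fun i => addv (x i) (x' i)) i = vmove x i + vmove x' i.
  by rewrite /vmove intcv_addv mulmxDr scalerDr.
have fm j : fmove (fun j => addv (y j) (y' j)) j = fmove y j + fmove y' j.
  by rewrite /fmove intcv_addv mulmxDr scalerDr.
rewrite /velocity add_row_mx; congr row_mx; apply/matrixP => k i.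
  rewrite [LHS]mxE [X in X + _ = _]mxE [X in _ + X = _]mxE [RHS]mxE vm.
  by rewrite [RHS]mxE.
rewrite [LHS]mxE [X in X + _ = _]mxE [X in _ + X = _]mxE [RHS]mxE fm dotDr.
have -> : (fmove y i + fmove y' i) k 0 = fmove y i k 0 + fmove y' i k 0.
  by rewrite [LHS]mxE.
by ring.
Qed.

(** The weights are divided by [kappa j] because the facet normals of the
    realization are scaled by [kappa j] relative to those of the standard
    24-cell. *)
Definition stress (h : 'M[R]_(4, 24 + 24)) : R :=
  \sum_j ((nsign (znormal (t j)))%:~R / kappa j) * \sum_i
    (vweight (s i) (t j))%:~R * dotcv (col j (rsubmx h)) (col i (lsubmx h)).

Lemma stress_continuous : continuous stress.
Proof.
move=> h; apply: (@cvg_sum_fin _ _ (nbhs h)) => j.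
apply: cvgM; first exact: cvg_cst.
apply: (@cvg_sum_fin _ _ (nbhs h)) => i.
apply: cvgM; first exact: cvg_cst.
exact: dot_col_continuous.
Qed.

Lemma stressZ r h : stress (r *: h) = r ^+ 2 * stress h.
Proof.
rewrite /stress mulr_sumr; apply: eq_bigr => j _.
rewrite mulrCA; congr (_ * _); rewrite mulr_sumr; apply: eq_bigr => i _.
rewrite !linearZ /= dotZl dotZr; ring.
Qed.

Lemma vweight_V j : \sum_i (vweight (s i) (t j))%:~R *: col i V = 0.
Proof.
under eq_bigr do rewrite VE scalerDr scalemxAr.
rewrite big_split -mulmx_sumr -scaler_suml /=.
rewrite (sum24_intcv R (f := fun i => vweight i (t j)) bs
  (all_ordP vweight_roots (t j))).
rewrite (sum24_label R (f := fun i => vweight i (t j)) bs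
    (all_ordP vweight_sum (t j))).
by rewrite mulmx0 scale0r addr0.
Qed.

Lemma nweight_A i : \sum_j ((nweight (s i) (t j))%:~R / kappa j) *: col j A = 0.
Proof.
rewrite -[LHS](mulKmx LTu) mulmx_sumr.
have -> : \sum_j L^T *m (((nweight (s i) (t j))%:~R / kappa j) *: col j A) =
    2^-1 *: \sum_j (nweight (s i) (t j))%:~R *: normalv (t j).
  rewrite scaler_sumr; apply: eq_bigr => j _; rewrite -scalemxAr AE !scalerA.
  by congr (_ *: _); field; rewrite kappa0.
rewrite (sum24_intcv R (f := fun j => nweight (s i) j) bt
  (all_ordP nweight_normals (s i))).
by rewrite scaler0 mulmx0.
Qed.

(** On an incident pair [(a' - a) . (v' - v) = 2 - a' . v - a . v'], and the
    weights sum to zero against constants, against [v] and against [a]. *)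
Lemma stress_realization VA' : realization_space P VA' -> stress (VA' - VA) = 0.
Proof.
move=> hVA'.
have term i j : (vweight (s i) (t j))%:~R *
    dotcv (col j (rsubmx (VA' - VA))) (col i (lsubmx (VA' - VA))) =
    (vweight (s i) (t j))%:~R * 2 -
    dotcv (col j (rsubmx VA')) ((vweight (s i) (t j))%:~R *: col i V) -
    (vweight (s i) (t j))%:~R * dotcv (col j A) (col i (lsubmx VA')).
  rewrite dotZr -!mulrBr /vweight; case: ifP => [ij|]; last by rewrite !mul0r.
  congr (_ * _); rewrite !linearB /= dotBl !dotBr -/A -/V AV//.
  have -> : dotcv (col j (rsubmx VA')) (col i (lsubmx VA')) = 1.
    exact/(realization_incidence i j hVA')/incst.
  by ring.
have -> : stress (VA' - VA) = - \sum_j ((nsign (znormal (t j)))%:~R / kappa j) *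
    \sum_i (vweight (s i) (t j))%:~R * dotcv (col j A) (col i (lsubmx VA')).
  rewrite -sumrN; apply: eq_bigr => j _; rewrite -mulrN; congr (_ * _).
  under eq_bigr do rewrite term.
  rewrite !sumrB -mulr_suml -dot_sumr vweight_V dot0r subr0.
  rewrite (sum24_label R (f := fun i => vweight i (t j)) bs
    (all_ordP vweight_sum (t j))).
  by rewrite mul0r sub0r.
apply/eqP; rewrite oppr_eq0; apply/eqP.
under eq_bigr do rewrite mulr_sumr.
rewrite exchange_big big1// => i _ /=.
have /(congr1 (fun x => (vsign (zroot (s i)))%:~R * dotcv x (col i (lsubmx VA')))) :=
  nweight_A i.
rewrite dot0l mulr0 dot_suml mulr_sumr => E; rewrite -[RHS]E.
apply: eq_bigr => j _; rewrite dotZl /vweight /nweight.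
by case: ifP => _; rewrite ?mul0r ?mulr0//; ring.
Qed.

(** The terms that come from the scaling of the normals cancel by
    [vweight_sum_x]. *)
Lemma stress_velocity : stress (velocity sum_x sum_y) = - (obstruction%:~R / 8).
Proof.
have term i j : (vweight (s i) (t j))%:~R * dotcv
    (col j (rsubmx (velocity sum_x sum_y))) (col i (lsubmx (velocity sum_x sum_y))) =
    dotcv c (fmove sum_y j) * (kappa j / 4) *
      (vweight (s i) (t j) * dotz (sum_x (s i)) (znormal (t j)))%:~R -
    kappa j / 8 * (vweight (s i) (t j) * dotz (sum_x (s i)) (sum_y (t j)))%:~R.
  rewrite row_mxKl row_mxKr.
  have -> : col i (\matrix_(k, i) vmove sum_x i k 0) = vmove sum_x i.
    by apply/colP => k; rewrite !mxE.
  have -> : col j (\matrix_(k, j)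
        (dotcv c (fmove sum_y j) * A k j - fmove sum_y j k 0)) =
      dotcv c (fmove sum_y j) *: col j A - fmove sum_y j.
    by apply/colP => k; rewrite !mxE.
  by rewrite dotBl dotZl dot_A_vmove dot_fmove_vmove !rmorphM; ring.
have -> : stress (velocity sum_x sum_y) = - (8^-1 * \sum_i \sum_j
    (vweight (s i) (t j) * nsign (znormal (t j)) *
       dotz (sum_x (s i)) (sum_y (t j)))%:~R).
  rewrite /stress exchange_big mulr_sumr -sumrN; apply: eq_bigr => j _ /=.
  under [X in _ * X = _]eq_bigr do rewrite term.
  rewrite sumrB -!mulr_sumr (sum24_label R (f := fun i => vweight i (t j) *
    dotz (sum_x i) (znormal (t j))) bs (all_ordP vweight_sum_x (t j))).
  rewrite mulr0 sub0r mulrN; congr (- _).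
  rewrite !mulr_sumr; apply: eq_bigr => i _; rewrite !rmorphM /=.
  by field; rewrite kappa0.
rewrite mulrC; congr (- (_ / _)).
rewrite /obstruction sum24E rmorph_sum /=.
rewrite [RHS](reindex s) /=; last exact: onW_bij.
apply: eq_bigr => i _; rewrite sum24E rmorph_sum /=.
by rewrite [RHS](reindex t) /=; last exact: onW_bij.
Qed.

Lemma not_smooth_deformation : ~ smooth_at (realization_space P) VA.
Proof.
move=> sm.
have := smooth_at_quadratic hVA sm stress_continuous stressZ stress_realization
  (curve_tangent compatible1) (curve_tangent compatible2).
rewrite velocity_add stress_velocity => /eqP.
rewrite oppr_eq0 mulf_eq0 invr_eq0 pnatr_eq0 orbF intr_eq0.
exact/negP/obstruction_neq0.
Qed.

End Deformation.

(** * The theorem *)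

Theorem theorem5p10 (R : realType) (P : labeled_polytope R 4 24 24)
    (hP : lp_body P = @cell24 R) (VA : 'M[R]_(4, 24 + 24))
    (hVA : realization_space P VA)
    (hreg : regular_polytope (conv_cols (lsubmx VA))) :
  ~ smooth_at (realization_space P) VA.
Proof.
have [s [t [bs bt st]]] := cell24_labels hP.
have [s' sK s'K] := bs; have [t' tK t'K] := bt.
pose V := lsubmx VA; pose A := rsubmx VA.
pose V1 := colsub s' V; pose A1 := colsub t' A.
have V1E i : col i V1 = col (s' i) V by apply/colP => k; rewrite !mxE.
have A1E j : col j A1 = col (t' j) A by apply/colP => k; rewrite !mxE.
have cV1 : conv_cols V1 = conv_cols V.
  congr convex_hull; apply/seteqP; split => _ [i _ <-].
    by rewrite V1E; exists (s' i).
  by exists (s i) => //; rewrite V1E sK.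
have [VAe _] := hVA.
have VA1 : conv_cols V1 = ineq_set A1.
  rewrite cV1 [LHS]VAe; apply/seteqP; split => x /ineqE xA; apply/ineqE => j.
    by rewrite A1E.
  by have := xA (t j); rewrite A1E tK.
have inc (i j : 'I_24) : dotcv (col j A1) (col i V1) = 1 <-> zinc i j.
  rewrite A1E V1E (realization_incidence (s' i) (t' j) hVA) -{2}(s'K i) -{2}(t'K j).
  exact: st.
have vert i : face (conv_cols V1) [set col i V1].
  by rewrite cV1 V1E; exact: (realization_vertex _ hVA).
have spF (j : 'I_24) : spans V1 [set i | zinc i j].
  move=> u hu; apply: (realization_facet_spans (j := t' j) hVA) => i /st.
  by rewrite t'K => ij; have := hu _ ij; rewrite V1E sK.
rewrite -cV1 in hreg.
apply: (@not_smooth_deformation R P VA s t (linpart V1) (bary V1)) => //.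
- exact: (linpart_unit VA1 inc vert spF hreg).
- by move=> i; rewrite -(regular_col VA1 inc vert hreg) V1E sK.
- move=> j; have := regular_facet VA1 inc vert hreg (t j).
  by rewrite /facet_scale A1E tK.
- move=> j; have := facet_scale_neq0 VA1 inc vert spF hreg (t j).
  by rewrite /facet_scale A1E tK.
Qed.
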